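(* Let $n\ge1$, $\theta\in(0,\frac{\pi}{2}]$ and let $\Sigma$ be a convex capillary hypersurface in $\overline{\mathbb{R}^{n+1}_+}$ with contact angle $\theta$. If the enclosed domain satisfies $\mathcal{I}_\theta(\widehat\Sigma)\le c_1$ for some positive constant $c_1$, then there exists a positive constant $c=c(n,c_1,\theta)$, depending only on $n$, $c_1$ and $\theta$, such that $$\rho_+(\widehat\Sigma,\theta)\le c\,\rho_-(\widehat\Sigma,\theta).$$
   Context: Let $E_{n+1}=(0,\dots,0,1)\in\mathbb{R}^{n+1}$, $\mathbb{R}^{n+1}_+=\{x:\langle x,E_{n+1}\rangle>0\}$, and let $\overline{\mathbb{R}^{n+1}_+}$ be its closure. A capillary hypersurface with contact angle $\theta$ is a smooth compact connected embedded hypersurface $\Sigma\subset\overline{\mathbb{R}^{n+1}_+}$ with nonempty boundary $\partial\Sigma\subset\partial\mathbb{R}^{n+1}_+$ and interior in $\mathbb{R}^{n+1}_+$, such that $\langle\nu,E_{n+1}\rangle=\cos\theta$ along $\partial\Sigma$. Here $\widehat\Sigma$ is the bounded (compact) domain in $\overline{\mathbb{R}^{n+1}_+}$ enclosed by $\Sigma$ and $\partial\mathbb{R}^{n+1}_+$, its boundary being $\Sigma\cup\widehat{\partial\Sigma}$ with $\widehat{\partial\Sigma}\subset\partial\mathbb{R}^{n+1}_+$, and $\nu$ is the unit normal of $\Sigma$ pointing out of $\widehat\Sigma$. $\Sigma$ is called convex if $\widehat\Sigma$ is convex. The capillary area is $W_\theta(\widehat\Sigma)=|\Sigma|-\cos\theta\,|\widehat{\partial\Sigma}|$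 and the capillary isoperimetric ratio is $\mathcal{I}_\theta(\widehat\Sigma)=W_\theta(\widehat\Sigma)^{n+1}/|\widehat\Sigma|^n$. For $r>0$ and $x_0\in\partial\mathbb{R}^{n+1}_+$ let $\mathcal{C}_{r,\theta}(x_0)=\{x\in\overline{\mathbb{R}^{n+1}_+}:|x-(x_0-r\cos\theta\,E_{n+1})|=r\}$ be the spherical cap, with enclosed domain $\widehat{\mathcal{C}_{r,\theta}(x_0)}=\{x\in\overline{\mathbb{R}^{n+1}_+}:|x-(x_0-r\cos\theta\,E_{n+1})|\le r\}$. The capillary inner and outer radii are $$\rho_-(\widehat\Sigma,\theta)=\sup\{r>0:\widehat{\mathcal{C}_{r,\theta}(x_0)}\subset\widehat\Sigma\text{ for some }x_0\in\partial\mathbb{R}^{n+1}_+\},$$ $$\rho_+(\widehat\Sigma,\theta)=\inf\{r>0:\widehat\Sigma\subset\widehat{\mathcal{C}_{r,\theta}(x_0)}\text{ for some }x_0\in\partial\mathbb{R}^{n+1}_+\}.$$ *)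

(* Defs.v *)
From HB Require Import structures.
From mathcomp Require Import all_boot all_order all_algebra.
From mathcomp Require Import all_classical all_reals all_analysis.

Set Implicit Arguments.
Unset Strict Implicit.
Unset Printing Implicit Defensive.

Import Order.TTheory GRing.Theory Num.Theory.
Import numFieldNormedType.Exports.

Local Open Scope classical_set_scope.
Local Open Scope ring_scope.

(* The library norm on 'rV[R]_m is the sup norm: it induces the usual topology,
   but lengths and angles have to be computed from the dot product. *)
Definition dotp {R : realType} {m : nat} (u v : 'rV[R]_m) : R :=
  \sum_(i < m) u 0 i * v 0 i.

Definition enorm {R : realType} {m : nat} (u : 'rV[R]_m) : R :=
  Num.sqrt (dotp u u).

Definition lebesgue_outer {R : realType} {m : nat} (A : set 'rV[R]_m) : \bar R :=
  ereal_inf [set (\sum_(0 <= k <oo) (\prod_(i < m) ((ab k).2 0 i - (ab k).1 0 i))%:E)%E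
            | ab in [set ab : nat -> 'rV[R]_m * 'rV[R]_m |
                (forall k i, (ab k).1 0 i <= (ab k).2 0 i) /\
                A `<=` \bigcup_k [set x | forall i,
                          (ab k).1 0 i <= x 0 i <= (ab k).2 0 i]]].

Definition unit_ball {R : realType} {m : nat} : set 'rV[R]_m :=
  [set x | enorm x <= 1].

(* 0 is added so that the empty set has diameter 0 rather than -oo. *)
Definition ediam {R : realType} {m : nat} (A : set 'rV[R]_m) : \bar R :=
  ereal_sup (0%E |` [set (enorm (x - y))%:E | x in A & y in A]).

(* Normalized so that the [d]-dimensional Hausdorff measure of a subset of a
   [d]-plane is its Lebesgue measure; meant for [0 < d], since [0 ^+ 0 = 1]
   would make empty members of a cover count. *)
Definition hausdorff {R : realType} {m : nat} (d : nat) (A : set 'rV[R]_m) :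
    \bar R :=
  ereal_sup [set ereal_inf
    [set (\sum_(0 <= k <oo)
            lebesgue_outer (@unit_ball R d) *
            ((2^-1)%:E * ediam (U k)) ^+ d)%E
    | U in [set U : nat -> set 'rV[R]_m |
        A `<=` \bigcup_k U k /\ forall k, (ediam (U k) <= delta%:E)%E]]
  | delta in [set delta : R | 0 < delta]].

Definition iter_partial {R : realType} {m p : nat} (s : seq 'I_m.+1)
    (f : 'rV[R]_m.+1 -> 'rV[R]_p.+1) : 'rV[R]_m.+1 -> 'rV[R]_p.+1 :=
  foldr (fun i g => 'D_(delta_mx 0 i) g) f s.

(* [f] is of class C^oo on [D], for [D] open. *)
Definition smooth_on {R : realType} {m p : nat} (D : set 'rV[R]_m.+1)
    (f : 'rV[R]_m.+1 -> 'rV[R]_p.+1) : Prop :=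
  forall (s : seq 'I_m.+1) (x : 'rV[R]_m.+1), D x ->
    {for x, continuous (iter_partial s f)} /\
    forall i, derivable (iter_partial s f) x (delta_mx 0 i).

Definition diffeo_on {R : realType} {m : nat} (U : set 'rV[R]_m.+1)
    (phi : 'rV[R]_m.+1 -> 'rV[R]_m.+1) : Prop :=
  [/\ open U, smooth_on U phi &
   exists (V : set 'rV[R]_m.+1) (psi : 'rV[R]_m.+1 -> 'rV[R]_m.+1),
     [/\ open V, smooth_on V psi,
         (forall x, U x -> V (phi x) /\ psi (phi x) = x) &
         (forall y, V y -> U (psi y) /\ phi (psi y) = y)]].

(* Slice charts of a hypersurface with boundary of R^(n+1), 1 <= n: around an
   interior point it is flattened to {y_last = 0}, around a boundary point to
   {y_last = 0, 0 <= y_first}, with the point sent to {y_first = 0}. *)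
Definition interior_chart {R : realType} {n : nat} (Sigma : set 'rV[R]_n.+1)
    (p : 'rV[R]_n.+1) (phi : 'rV[R]_n.+1 -> 'rV[R]_n.+1) : Prop :=
  exists U : set 'rV[R]_n.+1,
    [/\ U p, diffeo_on U phi &
     forall x, U x -> (Sigma x <-> phi x 0 ord_max = 0)].

Definition boundary_chart {R : realType} {n : nat} (Sigma : set 'rV[R]_n.+1)
    (p : 'rV[R]_n.+1) (phi : 'rV[R]_n.+1 -> 'rV[R]_n.+1) : Prop :=
  exists U : set 'rV[R]_n.+1,
    [/\ U p, diffeo_on U phi, phi p 0 ord0 = 0 &
     forall x, U x -> (Sigma x <-> phi x 0 ord_max = 0 /\ 0 <= phi x 0 ord0)].

Definition hs_interior {R : realType} {n : nat} (Sigma : set 'rV[R]_n.+1) :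
    set 'rV[R]_n.+1 :=
  [set p | Sigma p /\ exists phi, interior_chart Sigma p phi].

Definition hs_boundary {R : realType} {n : nat} (Sigma : set 'rV[R]_n.+1) :
    set 'rV[R]_n.+1 :=
  [set p | Sigma p /\ exists phi, boundary_chart Sigma p phi].

Definition embedded_hypersurface {R : realType} {n : nat}
    (Sigma : set 'rV[R]_n.+1) : Prop :=
  Sigma `<=` hs_interior Sigma `|` hs_boundary Sigma.

Definition tangent {R : realType} {n : nat} (Sigma : set 'rV[R]_n.+1)
    (p : 'rV[R]_n.+1) : set 'rV[R]_n.+1 :=
  [set v | exists phi,
     (interior_chart Sigma p phi \/ boundary_chart Sigma p phi) /\
     ('D_v phi p) 0 ord_max = 0].

Definition E_last {R : realType} {n : nat} : 'rV[R]_n.+1 := delta_mx 0 ord_max.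

Definition half_space {R : realType} {n : nat} : set 'rV[R]_n.+1 :=
  [set x | 0 < dotp x E_last].

Definition closed_half_space {R : realType} {n : nat} : set 'rV[R]_n.+1 :=
  [set x | 0 <= dotp x E_last].

Definition half_space_boundary {R : realType} {n : nat} : set 'rV[R]_n.+1 :=
  [set x | dotp x E_last = 0].

(* [K] is the compact domain enclosed by [Sigma] and the boundary hyperplane:
   its topological boundary consists of [Sigma] and of the part of [K] lying in
   that hyperplane. *)
Definition enclosed_domain {R : realType} {n : nat}
    (Sigma K : set 'rV[R]_n.+1) : Prop :=
  [/\ compact K, K `<=` closed_half_space, connected (interior K),
      closure (interior K) = K &
      K `\` interior K = Sigma `|` (K `&` half_space_boundary)].

(* At a boundary point of [Sigma] both [p + t nu] and [p - t nu] may leave [K],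
   so the outward condition is imposed at interior points and [nu] is determined
   along the boundary of [Sigma] by continuity. *)
Definition outer_unit_normal {R : realType} {n : nat}
    (Sigma K : set 'rV[R]_n.+1) (nu : 'rV[R]_n.+1 -> 'rV[R]_n.+1) : Prop :=
  [/\ {within Sigma, continuous nu},
      (forall p, Sigma p -> enorm (nu p) = 1),
      (forall p v, Sigma p -> tangent Sigma p v -> dotp (nu p) v = 0) &
      (forall p, hs_interior Sigma p ->
         \forall t \near (0 : R)^'+, ~ K (p + t *: nu p) /\ K (p - t *: nu p))].

Record capillary_hypersurface {R : realType} {n : nat} (theta : R)
    (Sigma K : set 'rV[R]_n.+1) : Prop := CapillaryHypersurface {
  cap_embedded : embedded_hypersurface Sigma ;
  cap_compact : compact Sigma ;
  cap_connected : connected Sigma ;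
  cap_bd_nonempty : hs_boundary Sigma !=set0 ;
  cap_bd : hs_boundary Sigma `<=` half_space_boundary ;
  cap_int : hs_interior Sigma `<=` half_space ;
  cap_enclosed : enclosed_domain Sigma K ;
  cap_angle : exists nu, outer_unit_normal Sigma K nu /\
    forall p, hs_boundary Sigma p -> dotp (nu p) E_last = cos theta }.

Definition convex_capillary {R : realType} {n : nat} (theta : R)
    (Sigma K : set 'rV[R]_n.+1) : Prop :=
  capillary_hypersurface theta Sigma K /\ convex_set K.

Definition capillary_area {R : realType} {n : nat} (theta : R)
    (Sigma K : set 'rV[R]_n.+1) : \bar R :=
  (hausdorff n Sigma -
   (cos theta)%:E * hausdorff n (K `&` half_space_boundary))%E.

(* With the conventions of \bar R, a domain of volume 0 and positive capillary
   area would have ratio +oo. *)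
Definition isoperimetric_ratio {R : realType} {n : nat} (theta : R)
    (Sigma K : set 'rV[R]_n.+1) : \bar R :=
  (capillary_area theta Sigma K ^+ n.+1 / lebesgue_outer K ^+ n)%E.

Definition cap_domain {R : realType} {n : nat} (r theta : R)
    (x0 : 'rV[R]_n.+1) : set 'rV[R]_n.+1 :=
  [set x | closed_half_space x /\
           enorm (x - (x0 - (r * cos theta) *: E_last)) <= r].

Definition rho_minus {R : realType} {n : nat} (K : set 'rV[R]_n.+1) (theta : R) :
    \bar R :=
  ereal_sup [set r%:E | r in [set r : R | 0 < r /\
    exists x0, half_space_boundary x0 /\ cap_domain r theta x0 `<=` K]].

Definition rho_plus {R : realType} {n : nat} (K : set 'rV[R]_n.+1) (theta : R) :
    \bar R :=
  ereal_inf [set r%:E | r in [set r : R | 0 < r /\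
    exists x0, half_space_boundary x0 /\ K `<=` cap_domain r theta x0]].

(* Main.v *)
Require Import Defs.
From HB Require Import structures.
From mathcomp Require Import all_boot all_order all_algebra.
From mathcomp Require Import all_classical all_reals all_analysis.
From mathcomp Require Import measurable_realfun.
From mathcomp Require Import ring lra.

Set Implicit Arguments.
Unset Strict Implicit.
Unset Printing Implicit Defensive.

Import Order.TTheory GRing.Theory Num.Theory.
Import numFieldNormedType.Exports.

Local Open Scope classical_set_scope.
Local Open Scope ring_scope.

(** Let [A] be the area of [Sigma], [V] the volume of [K], and let C stand for constants that
    depend only on [n], [theta] and [c1].

    Every coordinate ray from a point of [K] leaves [K] through [Sigma] ([exit_through]). In the
    vertical direction this shows that the base of [K] is no larger than [Sigma], so that the
    capillary area is at least [(1 - cos theta) A], and the bound on the isoperimetric ratio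
    becomes A^(n+1) <= C V^n ([isoperimetric_bound]).

    The length that governs [K] is [l = V / (C A)]. If all chords of [K] parallel to some
    coordinate axis had length at most [l], then the sets of a cover of [Sigma], prolonged by
    [l] along that axis, would cover [K], and the volume would be too small
    ([volume_le_chord_area]). So there are chords longer than [l] in all coordinate directions,
    and the average of such chords is a cross-polytope of radius of order [l] in [K], around a
    point [m] ([chords_cross_polytope]). In turn A <= C l^n. If a point of [K] is at distance
    [tau] from [m] along some axis, then the hull of this point and of the cross-polytope
    contains a tube of length tau / 2 and width of order [l]. A projection of [Sigma] covers the
    projection of the tube, so A >= tau l^(n-1) / C ([area_ge_extent]) and tau <= C l. This bounds
    the outer radius by C l ([rho_plus_le]).

    The inner radius needs a cap centred on the hyperplane. Because the contact angle is at most
    pi / 2, [K] contains the vertical projection of each of its points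
    ([capillary_projection]). Projecting the cross-polytope to the hyperplane and adding a
    vertical segment gives half of a cross-polytope that rests on the hyperplane, and it contains
    a cap of radius of order [l] ([rho_minus_ge]). The projection property rests on the fact that
    [K] lies on the inner side of the tangent planes of [Sigma] ([tangent_plane_support]),
    together with the continuity of the normal up to the boundary of [Sigma].

    The measures are only compared up to constant factors: volumes are bounded above by covering
    with boxes, and areas are bounded below by integrating, one coordinate at a time, the number
    of boxes of a cover ([weighted_cover_box]). *)

(** * Covers by boxes *)

Lemma weighted_cover_itv (R : realType) (c p q : R) (w a b : nat -> R) :
  p <= q -> (forall k, 0 <= w k) -> (forall k, a k <= b k) ->
  (forall t, p <= t <= q ->
     (c%:E <= \sum_(0 <= k <oo) (w k * (a k <= t <= b k)%R%:R)%:E)%E) ->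
  ((c * (q - p))%:E <= \sum_(0 <= k <oo) (w k * (b k - a k))%:E)%E.
Proof.
move=> pq w0 ab H.
pose mu := @lebesgue_measure R.
pose D : set (R) := `[p, q]%classic.
have mD : measurable D by exact: measurable_itv.
have muitv (x y : R) : x <= y -> mu `[x, y]%classic = (y - x)%:E.
  move=> xy; have := lebesgue_measure_itv `[x, y]; rewrite /mu /= lte_fin => ->.
  case: ltP => // yx.
  by rewrite (le_anti (introT andP (conj xy yx))) subrr.
pose g k : R -> \bar R :=
  fun t => (\1_(`[a k, b k]%classic : set (R)) t)%:E.
pose f k t : \bar R := ((w k)%:E * g k t)%E.
have mI k : measurable_fun D (g k).
  exact/measurable_EFinP/measurable_funTS/measurable_indic.
have f0 k t : D t -> (0 <= f k t)%E.
  by move=> _; rewrite /f /g -EFinM lee_fin mulr_ge0 ?w0 // indicE ler0n.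
have mf k : measurable_fun D (f k).
  by apply: emeasurable_funM => //; exact: measurable_cst.
have -> : (c * (q - p))%:E = (\int[mu]_(t in D) cst c%:E t)%E.
  by rewrite integral_cst // [X in (_ * X)%E](muitv _ _ pq).
have intle : (\int[mu]_(t in D) (cst c%:E t) <=
              \int[mu]_(t in D) (\sum_(0 <= k <oo) f k t))%E.
  have [c0|c0] := leP 0 c; last first.
    apply: (@le_trans _ _ 0%E).
      rewrite integral_cst // [X in (_ * X)%E](muitv _ _ pq) -EFinM lee_fin.
      by rewrite nmulr_rle0 ?subr_ge0.
    by apply: integral_ge0 => t Dt; apply: nneseries_ge0 => k _ _; exact: f0.
  apply: ge0_le_integral => //.
  - rewrite (_ : (fun t => _) = (fun t => \sum_(0 <= k <oo | k \in xpredT) f k t)%E).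
      by apply: ge0_emeasurable_sum => [k t Dt _|k _]; [exact: f0|exact: mf].
    by apply/funext => t; apply: eq_eseriesl.
  - move=> t Dt; have tpq : p <= t <= q by move: Dt; rewrite /D /= in_itv.
    apply: (le_trans (H t tpq)); apply: lee_nneseries => [k _ _|k _]; rewrite ?lee_fin.
      by rewrite mulr_ge0 // ler0n.
    by rewrite indicE mem_setE in_itv.
apply: le_trans intle _; rewrite integral_nneseries //.
apply: lee_nneseries => [k _ _|k _].
  by apply: integral_ge0 => t; exact: f0.
have g0 t : D t -> (0 <= g k t)%E by rewrite /g lee_fin indicE ler0n.
have E : (\int[mu]_(x in D) f k x = (w k)%:E * \int[mu]_(x in D) g k x)%E.
  by apply: ge0_integralZl_EFin => //; exact: mI.
have E2 : (\int[mu]_(x in D) g k x = mu (`[a k, b k]%classic `&` D))%E.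
  by apply: integral_indic => //; exact: measurable_itv.
rewrite [leLHS]E E2.
rewrite EFinM; apply: lee_wpmul2l; first by rewrite lee_fin w0.
rewrite -muitv //; apply: le_measure; rewrite ?inE //.
by apply: measurableI.
Qed.

(** Integrating out one coordinate turns a weighted cover into another one, in which each weight
    is multiplied by a side of its box; the weights are there for this induction. *)
Lemma weighted_cover_box (R : realType) (m : nat) (s : seq 'I_m) (c : R)
    (w : nat -> R) (p q : 'I_m -> R) (a b : nat -> 'I_m -> R) :
  uniq s -> (forall i, p i <= q i) -> (forall k, 0 <= w k) ->
  (forall k i, a k i <= b k i) ->
  (forall y : 'I_m -> R, (forall i, i \in s -> p i <= y i <= q i) ->
     (c%:E <= \sum_(0 <= k <oo)
        (w k * \prod_(i <- s) (a k i <= y i <= b k i)%R%:R)%:E)%E) ->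
  ((c * \prod_(i <- s) (q i - p i))%:E <=
     \sum_(0 <= k <oo) (w k * \prod_(i <- s) (b k i - a k i))%:E)%E.
Proof.
move=> + pq + ab; elim: s c w => [|i s IH] c w.
  move=> _ w0 /(_ p) H; rewrite big_nil mulr1.
  apply: le_trans (H _) _; first by move=> i; rewrite in_nil.
  by apply: lee_nneseries => [k _ _|k _]; rewrite !big_nil // lee_fin mulr_ge0.
move=> /= /andP[nis us] w0 H.
under eq_eseriesr do rewrite big_cons mulrA.
rewrite big_cons mulrA; apply: IH => //.
  by move=> k; rewrite mulr_ge0 ?subr_ge0.
move=> y ys; under eq_eseriesr do rewrite mulrAC.
apply: weighted_cover_itv => //.
  by move=> k; rewrite mulr_ge0 // prodr_ge0.
move=> t tpq; pose y' j := if j == i then t else y j.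
have /le_trans -> // : (c%:E <= \sum_(0 <= k <oo)
     (w k * \prod_(j <- i :: s) (a k j <= y' j <= b k j)%R%:R)%:E)%E.
  apply: H => j; rewrite inE /y'; case: eqP => [-> //|_] /=; exact: ys.
apply: lee_nneseries => [k _ _|k _].
  by rewrite lee_fin mulr_ge0 // prodr_ge0.
rewrite big_cons (_ : y' i = t) ?/y' ?eqxx // mulrCA mulrC lee_fin.
rewrite le_eqVlt; apply/orP; left; apply/eqP; congr (_ * _ * _).
rewrite big_seq [RHS]big_seq; apply: eq_bigr => j js.
by case: eqP js => // ->; rewrite (negbTE nis).
Qed.

Lemma nneseries_ge_term (R : realType) (u : nat -> \bar R) (k : nat) :
  (forall k, (0 <= u k)%E) -> (u k <= \sum_(0 <= k <oo) u k)%E.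
Proof.
move=> u0; apply: le_trans (nneseries_lim_ge k.+1 _) => //.
by rewrite big_nat_recr //= leeDr // sume_ge0.
Qed.

Lemma nneseries_first (R : realType) (u : nat -> \bar R) :
  (forall k, (0 <= u k)%E) -> (forall k, u k.+1 = 0%E) ->
  (\sum_(0 <= k <oo) u k = u 0%N)%E.
Proof.
move=> u0 uS; rewrite (nneseries_split 0 1) // big_nat1 add0n.
rewrite eseries0 ?adde0 // => -[//|k] _ _; exact: uS.
Qed.

Lemma coord_le_enorm (R : realType) (m : nat) (u : 'rV[R]_m) (i : 'I_m) :
  `|u 0 i| <= enorm u.
Proof.
rewrite /enorm -sqrtr_sqr ler_wsqrtr // /dotp (bigD1 i) //= -expr2 lerDl.
by apply: sumr_ge0 => j _; rewrite -expr2 sqr_ge0.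
Qed.

Lemma enorm_le_sum (R : realType) (m : nat) (u : 'rV[R]_m) :
  enorm u <= \sum_i `|u 0 i|.
Proof.
have s0 : 0 <= \sum_i `|u 0 i| by apply: sumr_ge0.
rewrite /enorm -(ger0_norm s0) -sqrtr_sqr ler_wsqrtr // expr2 mulr_suml.
apply: ler_sum => i _; rewrite -expr2 -real_normK ?num_real // expr2.
by rewrite ler_wpM2l // (bigD1 i) //= lerDl sumr_ge0.
Qed.

Lemma enorm_le_coord (R : realType) (m : nat) (u : 'rV[R]_m) (r : R) :
  (forall i, `|u 0 i| <= r) -> enorm u <= m%:R * r.
Proof.
move=> ur; apply: (le_trans (enorm_le_sum _)).
apply: (le_trans (ler_sum _ (fun i _ => ur i))).
by rewrite sumr_const card_ord mulr_natl.
Qed.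

(** * Lebesgue outer measure *)

Lemma lebesgue_outer_le (R : realType) (m : nat) (A : set 'rV[R]_m)
    (a b : nat -> 'I_m -> R) :
  (forall k i, a k i <= b k i) ->
  (forall x, A x -> exists k, forall i, a k i <= x 0 i <= b k i) ->
  (lebesgue_outer A <= \sum_(0 <= k <oo) (\prod_i (b k i - a k i))%:E)%E.
Proof.
move=> ab cov; apply: ereal_inf_lbound.
exists (fun k => (\row_i a k i, \row_i b k i)); last first.
  by apply: eq_eseriesr => k _; congr EFin; apply: eq_bigr => i _; rewrite !mxE.
split=> [k i|x /cov[k H]]; first by rewrite !mxE.
by exists k => // i; rewrite !mxE.
Qed.

Lemma lebesgue_outer_ge (R : realType) (m : nat) (A : set 'rV[R]_m) (c : \bar R) :
  (forall a b : nat -> 'I_m -> R, (forall k i, a k i <= b k i) ->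
    (forall x, A x -> exists k, forall i, a k i <= x 0 i <= b k i) ->
    (c <= \sum_(0 <= k <oo) (\prod_i (b k i - a k i))%:E)%E) ->
  (c <= lebesgue_outer A)%E.
Proof.
move=> H; apply: le_ereal_inf_tmp => _ [ab [le_ab cov] <-].
apply: (H (fun k => (ab k).1 0) (fun k => (ab k).2 0)) => // x /cov[k _ ?].
by exists k.
Qed.

Lemma lebesgue_outer_ge0 (R : realType) (m : nat) (A : set 'rV[R]_m) :
  (0 <= lebesgue_outer A)%E.
Proof.
apply: lebesgue_outer_ge => a b ab _; apply: nneseries_ge0 => k _ _.
by rewrite lee_fin prodr_ge0 // => i _; rewrite subr_ge0.
Qed.

Lemma lebesgue_outer_box_lt (R : realType) (m : nat) (A : set 'rV[R]_m) (M : R) :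
  (0 < m)%N -> (forall x i, A x -> `|x 0 i| <= M) -> (lebesgue_outer A < +oo)%E.
Proof.
move=> m0 AM; have [[x Ax]|A0] := pselect (exists x, A x); last first.
  apply: (@le_lt_trans _ _ (\sum_(0 <= k <oo) (\prod_(i < m) ((0:R) - 0))%:E)%E).
    apply: (@lebesgue_outer_le R m A (fun _ _ => 0) (fun _ _ => 0)) => // x Ax.
    by case: A0; exists x.
  by rewrite eseries0 // => k _ _; rewrite (bigD1 (Ordinal m0)) //= subrr mul0r.
have M0 : 0 <= M by apply: le_trans (AM x (Ordinal m0) Ax).
pose b k (i : 'I_m) : R := if k is 0%N then M else 0.
apply: (@le_lt_trans _ _ (\sum_(0 <= k <oo) (\prod_(i < m) (b k i - - b k i))%:E)%E).
  apply: lebesgue_outer_le.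
    by move=> [|k] i /=; rewrite ?oppr0 // ge0_cp.
  by move=> y Ay; exists 0%N => i /=; rewrite -ler_norml AM.
rewrite nneseries_first ?ltry //.
  move=> [|k]; rewrite lee_fin prodr_ge0 // => i _ /=; rewrite ?oppr0 ?addr0 //.
  by rewrite opprK addr_ge0.
by move=> k; rewrite (bigD1 (Ordinal m0)) //= opprK addr0 mul0r.
Qed.

(** The measure is positive because a cover of the ball covers a cube inscribed in it; for
    [m = 0] it would be infinite, as degenerate boxes then have volume 1. *)
Lemma lebesgue_outer_unit_ball (R : realType) (m : nat) :
  (0 < m)%N ->
  exists2 w : R, 0 < w & lebesgue_outer (@unit_ball R m) = w%:E.
Proof.
move=> m0.
have fin : lebesgue_outer (@unit_ball R m) \is a fin_num.
  rewrite ge0_fin_numE ?lebesgue_outer_ge0 //.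
  apply: (@lebesgue_outer_box_lt R m _ 1) => // x i; apply: le_trans.
  exact: coord_le_enorm.
exists (fine (lebesgue_outer (@unit_ball R m))); last by rewrite fineK.
rewrite -lte_fin fineK //.
pose r : R := m%:R^-1; have r0 : 0 < r by rewrite invr_gt0 ltr0n.
apply: (@lt_le_trans _ _ (1 * \prod_(i < m) (r - - r))%:E).
  by rewrite lte_fin mul1r prodr_gt0 // => i _; rewrite opprK addr_gt0.
apply: lebesgue_outer_ge => a b ab cov.
under [leRHS]eq_eseriesr do rewrite -[X in X%:E]mul1r.
apply: weighted_cover_box => //; first exact: index_enum_uniq.
  by move=> i; rewrite ge0_cp // ltW.
move=> y yr; have [|k yk] := cov (\row_i y i).
  rewrite /unit_ball /=; apply: le_trans (@enorm_le_coord _ _ _ r _) _.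
    by move=> i; rewrite mxE ler_norml yr ?mem_index_enum.
  by rewrite /r mulfV // pnatr_eq0 -lt0n.
apply: le_trans (nneseries_ge_term k _); last first.
  by move=> k'; rewrite mul1r lee_fin prodr_ge0.
rewrite mul1r lee_fin big1 // => i _; have := yk i; rewrite mxE => ->.
by [].
Qed.

(** * Hausdorff measure *)

Lemma expe_le (R : realType) (x y : \bar R) (n : nat) :
  (0 <= x -> x <= y -> x ^+ n <= y ^+ n)%E.
Proof.
move=> x0 xy; elim: n => [|n IH]; rewrite ?expe0 // !expeS.
by apply: lee_pmul; rewrite ?expe_ge0.
Qed.

Lemma ediam_ge0 (R : realType) (m : nat) (A : set 'rV[R]_m) : (0 <= ediam A)%E.
Proof. by apply: ereal_sup_ubound; left. Qed.

Lemma ediam_ge (R : realType) (m : nat) (A : set 'rV[R]_m) (x y : 'rV[R]_m) :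
  A x -> A y -> ((enorm (x - y))%:E <= ediam A)%E.
Proof. by move=> Ax Ay; apply: ereal_sup_ubound; right; exists x => //; exists y. Qed.

Lemma ediam_le (R : realType) (m : nat) (A : set 'rV[R]_m) (d : R) :
  0 <= d -> (forall x y, A x -> A y -> enorm (x - y) <= d) ->
  (ediam A <= d%:E)%E.
Proof.
move=> d0 Ad; apply: ge_ereal_sup => _ [->|[x Ax [y Ay <-]]]; rewrite lee_fin //.
exact: Ad.
Qed.

Lemma hausdorff_term_ge0 (R : realType) (m n : nat) (A : set 'rV[R]_m) :
  (0 <= lebesgue_outer (@unit_ball R n) * ((2^-1)%:E * ediam A) ^+ n)%E.
Proof.
apply: mule_ge0; first exact: lebesgue_outer_ge0.
by apply: expe_ge0; rewrite mule_ge0 ?ediam_ge0 // lee_fin invr_ge0.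
Qed.

Lemma hausdorff_ge0 (R : realType) (m n : nat) (A : set 'rV[R]_m) :
  (0 <= hausdorff n A)%E.
Proof.
apply: le_ereal_sup_tmp; eexists; first by exists 1 => //=; exact: ltr01.
apply: le_ereal_inf_tmp => _ [U _ <-]; apply: nneseries_ge0 => k _ _.
exact: hausdorff_term_ge0.
Qed.

(** A cover of [A] is mapped to a cover of [B] whose members have no larger diameters. *)
Lemma hausdorff_lipschitz (R : realType) (m n p : nat) (f : 'rV[R]_m -> 'rV[R]_p)
    (A : set 'rV[R]_m) (B : set 'rV[R]_p) :
  (forall x y, enorm (f x - f y) <= enorm (x - y)) ->
  (forall y, B y -> exists2 x, A x & f x = y) ->
  (hausdorff n B <= hausdorff n A)%E.
Proof.
move=> f1 BA; apply: ge_ereal_sup => _ [delta d0 <-].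
apply: le_ereal_sup_tmp; eexists; first by exists delta.
apply: le_ereal_inf_tmp => _ [U [AU Ud] <-].
have fU k : (ediam (f @` U k) <= ediam (U k))%E.
  apply: ge_ereal_sup => _ [->|[_ [x Ux <-] [_ [y Uy <-] <-]]].
    exact: ediam_ge0.
  by apply: le_trans (ediam_ge Ux Uy); rewrite lee_fin.
apply: ge_ereal_inf; eexists.
  exists (fun k => f @` U k); last reflexivity; split=> [y /BA[x /AU[k _ Ux] <-]|k].
    by exists k => //; exists x.
  exact: le_trans (fU k) (Ud k).
apply: lee_nneseries => k _; first by move=> _; exact: hausdorff_term_ge0.
apply: lee_wpmul2l; first exact: lebesgue_outer_ge0.
apply: expe_le; first by rewrite mule_ge0 ?ediam_ge0 // lee_fin invr_ge0.
by apply: lee_wpmul2l => //; rewrite lee_fin invr_ge0.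
Qed.

(** A set of diameter [d] lies in a cube of side [2 d], so that covers by boxes,
    for which volumes can be computed, are no worse up to a constant factor. *)
Lemma hausdorff_cube_cover (R : realType) (m n : nat) (w delta M : R)
    (A : set 'rV[R]_m) :
  0 < w -> lebesgue_outer (@unit_ball R n) = w%:E -> 0 < delta ->
  (hausdorff n A < M%:E)%E ->
  exists (u : nat -> 'rV[R]_m) (d : nat -> R),
    [/\ forall k, 0 <= d k <= delta,
        forall x, A x -> exists k, forall i, `|x 0 i - u k 0 i| <= d k &
        (\sum_(0 <= k <oo) (d k ^+ n)%:E <= (2 ^+ n / w * M)%:E)%E].
Proof.
move=> w0 Ew d0 AM.
have : (ereal_inf [set (\sum_(0 <= k <oo) lebesgue_outer (@unit_ball R n) *
      ((2^-1)%:E * ediam (U k)) ^+ n)%E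
    | U in [set U : nat -> set 'rV[R]_m |
        A `<=` \bigcup_k U k /\ forall k, (ediam (U k) <= delta%:E)%E]] < M%:E)%E.
  by apply: le_lt_trans AM; apply: ereal_sup_ubound; exists delta.
move=> /ereal_inf_lt[_ [U [AU Ud] <-]] UM.
have Ufin k : ediam (U k) = (fine (ediam (U k)))%:E.
  rewrite fineK // ge0_fin_numE ?ediam_ge0 //.
  by apply: le_lt_trans (Ud k) _; rewrite ltry.
have /choice[u uU] k : exists u : 'rV[R]_m, forall x, U k x -> U k u.
  have [[u Uu]|U0] := pselect (exists u, U k u); first by exists u.
  by exists 0 => x Ux; case: U0; exists x.
exists u, (fun k => fine (ediam (U k))); split=> [k|x /AU[k _ Ux]|].
- rewrite -(lee_fin 0) -(lee_fin _ delta) -Ufin ediam_ge0; exact: Ud.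
- exists k => i; rewrite -lee_fin -Ufin.
  apply: le_trans (ediam_ge Ux (uU k x Ux)); rewrite lee_fin.
  by have := coord_le_enorm (x - u k) i; rewrite !mxE.
- have E k : (fine (ediam (U k)) ^+ n)%:E = ((2 ^+ n / w)%:E *
       (lebesgue_outer (@unit_ball R n) * ((2^-1)%:E * ediam (U k)) ^+ n))%E.
    rewrite [in RHS]Ufin -EFinM -EFin_expe Ew -!EFinM; congr EFin.
    rewrite exprMn exprVn; field; rewrite ?gt_eqF //=.
  under eq_eseriesr do rewrite E.
  rewrite nneseriesZl; last by move=> k _; exact: hausdorff_term_ge0.
  rewrite [leRHS]EFinM; apply: lee_wpmul2l; last exact: ltW.
  by rewrite lee_fin divr_ge0 ?exprn_ge0 // ltW.
Qed.

(** A flat bounded set is cut into [N ^ n] cubes whose sides are of order [1 / N], so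
    that the sums of the [n]-th powers of the diameters stay bounded. *)
Lemma hausdorff_flat_lt (R : realType) (n : nat) (A : set 'rV[R]_n.+1) (M : R) :
  (0 < n)%N -> 0 < M ->
  (forall x, A x -> x 0 ord_max = 0 /\ forall i, `|x 0 i| <= M) ->
  (hausdorff n A < +oo)%E.
Proof.
move=> n0 M0 AM; have [w w0 Ew] := lebesgue_outer_unit_ball R n0.
apply: (@le_lt_trans _ _ (w * (n.+1%:R * M) ^+ n)%:E); last by rewrite ltry.
apply: ge_ereal_sup => _ [delta /= d0 <-].
pose N := Num.truncn (2 * n.+1%:R * M / delta).
pose h : R := 2 * M / N.+1%:R.
have N0 : 0 < N.+1%:R :> R by rewrite ltr0n.
have h0 : 0 < h by rewrite /h divr_gt0 // mulr_gt0.
have hd : n.+1%:R * h <= delta.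
  rewrite /h mulrA ler_pdivrMr // -ler_pdivrMl // ltW //.
  have /truncn_itv/andP[_] : 0 <= 2 * n.+1%:R * M / delta.
    by rewrite divr_ge0 ?mulr_ge0 // ltW.
  apply: le_lt_trans; rewrite le_eqVlt; apply/orP; left; apply/eqP; ring.
pose T : finType := {ffun 'I_n -> 'I_N.+1}.
pose cell (f : T) : set 'rV[R]_n.+1 := [set x | x 0 ord_max = 0 /\
  forall i : 'I_n, - M + (f i)%:R * h <= x 0 (widen_ord (leqnSn n) i)
                   <= - M + (f i)%:R * h + h].
pose U k : set 'rV[R]_n.+1 :=
  if insub k : option 'I_#|T| is Some j then cell (enum_val j) else set0.
have diamU k : (ediam (U k) <= (if (k < #|T|)%N then n.+1%:R * h else 0)%:E)%E.
  apply: ediam_le; first by case: ifP => // _; rewrite mulr_ge0 // ltW.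
  move=> x y; rewrite /U; case: insubP => // j -> _ [xl xc] [yl yc].
  apply: enorm_le_coord => i; rewrite !mxE.
  have [->|ni] := eqVneq i ord_max; first by rewrite xl yl subrr normr0 ltW.
  have in_ : (i < n)%N.
    by rewrite ltn_neqAle -ltnS ltn_ord andbT; apply: contraNN ni => /eqP e; apply/eqP/val_inj.
  have := xc (Ordinal in_); have := yc (Ordinal in_).
  rewrite (_ : widen_ord _ _ = i); last exact: val_inj.
  by move=> /andP[? ?] /andP[? ?]; rewrite ler_norml; apply/andP; split; lra.
apply: ge_ereal_inf; eexists.
  exists U; last reflexivity; split=> [x Ax|k]; last first.
    apply: le_trans (diamU k) _; rewrite lee_fin; case: ifP => // _; exact: ltW.
  have [xl xM] := AM x Ax.
  (* The minimum with [N] is attained on the last face, where the coordinate is [M]. *)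
  pose f : T := [ffun i =>
    inord (minn (Num.truncn ((x 0 (widen_ord (leqnSn n) i) + M) / h)) N)].
  exists (enum_rank f) => //; rewrite /U insubT ?ltn_ord // => Hk.
  rewrite (_ : Sub _ _ = enum_rank f); last exact: val_inj.
  rewrite enum_rankK; split=> // i; rewrite ffunE inordK; last by rewrite ltnS geq_minr.
  set y := x 0 _; have := xM (widen_ord (leqnSn n) i); rewrite -/y ler_norml => /andP[y1 y2].
  have q0 : 0 <= (y + M) / h by rewrite divr_ge0 ?(ltW h0) //; lra.
  have /andP[t1 t2] := truncn_itv q0.
  move: t1 t2; set t := Num.truncn _; rewrite ler_pdivlMr // ltr_pdivrMr // => t1 t2.
  have hN : N.+1%:R * h = 2 * M by rewrite /h mulrC divfK // gt_eqF.
  move: t2 hN; rewrite -!natr1 !mulrDl !mul1r => t2 hN.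
  rewrite /minn; case: ltnP => tN; first by apply/andP; split; lra.
  have : N%:R * h <= t%:R * h by rewrite ler_pM2r // ler_nat.
  by move=> ?; apply/andP; split; lra.
pose c : R := w * (2^-1 * (n.+1%:R * h)) ^+ n.
have c0 : 0 <= c by rewrite mulr_ge0 ?exprn_ge0 ?mulr_ge0 ?invr_ge0 // ltW.
apply: (@le_trans _ _ (\sum_(0 <= k <oo) (if (k < #|T|)%N then c else 0)%:E)%E).
  apply: lee_nneseries => [k _ _|k _]; first exact: hausdorff_term_ge0.
  rewrite Ew (_ : (if _ then c else 0) =
    w * (2^-1 * (if (k < #|T|)%N then n.+1%:R * h else 0)) ^+ n); last first.
    by case: ifP => // _; rewrite mulr0 expr0n eqn0Ngt n0 mulr0.
  rewrite EFinM EFin_expe EFinM; apply: lee_wpmul2l; first by rewrite lee_fin ltW.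
  apply: expe_le; first by rewrite mule_ge0 ?ediam_ge0 // lee_fin invr_ge0.
  by apply: lee_wpmul2l; rewrite ?lee_fin ?invr_ge0.
rewrite (nneseries_split 0 #|T|); last by move=> k _; rewrite lee_fin; case: ifP.
rewrite add0n eseries0 ?adde0; last by move=> k Tk _; rewrite ltnNge Tk.
rewrite big_mkord sumEFin lee_fin (eq_bigr (fun=> c)); last by move=> k _; rewrite ltn_ord.
have cT : #|T| = (N.+1 ^ n)%N by rewrite card_ffun !card_ord.
rewrite sumr_const card_ord cT -[c *+ _]mulr_natl natrX /c.
rewrite mulrCA -exprMn le_eqVlt; apply/orP; left; apply/eqP; congr (_ * _ ^+ _).
by rewrite /h; field; rewrite gt_eqF.
Qed.

(** * Topology and convexity in coordinates *)

Lemma nbhs_coord (R : realType) (n : nat) (x : 'rV[R]_n.+1) (A : set 'rV[R]_n.+1) :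
  nbhs x A <-> exists2 e : R, 0 < e &
    forall y : 'rV[R]_n.+1, (forall i, `|y 0 i - x 0 i| < e) -> A y.
Proof.
split=> [/nbhs_ballP[e /= e0 xA]|[e e0 xA]].
  exists e => // y xy; apply: xA; split=> // i j.
  by rewrite ord1 -ball_normE /= distrC.
apply/nbhs_ballP; exists e => //= y [_ xy]; apply: xA => i.
by have := xy 0 i; rewrite -ball_normE /= distrC.
Qed.

Lemma closedN_coord (R : realType) (n : nat) (x : 'rV[R]_n.+1) (A : set 'rV[R]_n.+1) :
  closed A -> ~ A x ->
  exists2 e : R, 0 < e & forall y : 'rV[R]_n.+1, (forall i, `|y 0 i - x 0 i| < e) -> ~ A y.
Proof. by move=> /closed_openC Ac Ax; apply/nbhs_coord; exact: open_nbhs_nbhs. Qed.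

Lemma compact_coord_bounded (R : realType) (n : nat) (A : set 'rV[R]_n.+1) :
  compact A -> exists2 M : R, 0 < M & forall x i, A x -> `|x 0 i| <= M.
Proof.
move=> /compact_bounded/ex_strict_bound_gt0[M M0 AM]; exists M => // x i /AM /= /ltW.
apply: le_trans; rewrite [leRHS]/Num.Def.normr /= mx_normrE.
exact: (le_bigmax _ (fun ij => `|x ij.1 ij.2|) (ord0, i)).
Qed.

Lemma convex_set_segment (R : realType) (n : nat) (K : set 'rV[R]_n.+1)
    (x y : 'rV[R]_n.+1) (t : R) :
  convex_set K -> K x -> K y -> 0 <= t <= 1 -> K (x + t *: (y - x)).
Proof.
move=> cK Kx Ky /andP[t0 t1].
have t01 : Itv.spec (@Itv.num_sem R) (Itv.Real `[0%Z, 1%Z]) t.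
  by rewrite /Itv.spec /= /Itv.num_sem /= num_real in_itv /= t0 t1.
have := cK y x (Itv.mk t01); rewrite !inE => /(_ Ky Kx).
rewrite /conv /= /unstable.onem.
by rewrite scalerBl scale1r scalerBr addrCA.
Qed.

(** By induction on [s]: one point is split off and the remaining weights are divided by
    [1 - l i]. *)
Lemma convex_set_sum (R : realType) (n : nat) (K : set 'rV[R]_n.+1) (I : eqType)
    (s : seq I) (m : 'rV[R]_n.+1) (b : I -> 'rV[R]_n.+1) (l : I -> R) :
  convex_set K -> K m -> (forall i, K (m + b i)) -> (forall i, 0 <= l i) ->
  \sum_(i <- s) l i <= 1 -> K (m + \sum_(i <- s) l i *: b i).
Proof.
move=> cK Km Kb; elim: s l => [|i s IH] l l0; first by rewrite !big_nil addr0.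
rewrite !big_cons => l1.
have s0 : 0 <= \sum_(j <- s) l j by apply: sumr_ge0.
have [li1|li1] := ltP (l i) 1; last first.
  have {}s0 : \sum_(j <- s) l j == 0 by rewrite eq_le s0 andbT; lra.
  have lE : l i = 1 by apply/eqP; rewrite eq_le li1 andbT; lra.
  rewrite lE scale1r (_ : \sum_(j <- s) _ = 0) ?addr0 //.
  move: s0; rewrite psumr_eq0 // => /allP s0.
  elim: s s0 {IH l1} => [|j s IH] s0; first by rewrite big_nil.
  rewrite big_cons IH ?addr0; last by move=> k ks; apply: s0; rewrite inE ks orbT.
  by have /eqP -> := s0 j (mem_head _ _); rewrite scale0r.
have := IH (fun j => (1 - l i)^-1 * l j) _ _.
rewrite -mulr_sumr => IH'.
have {}IH' : K (m + \sum_(j <- s) ((1 - l i)^-1 * l j) *: b j).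
  apply: IH' => [j|]; first by rewrite mulr_ge0 // invr_ge0; lra.
  by rewrite ler_pdivrMl; lra.
have := @convex_set_segment R n K _ _ (l i) cK IH' (Kb i) _.
rewrite l0 (ltW li1) => /(_ isT); congr K.
rewrite opprD [m + b i + _]addrACA subrr add0r scalerBr -!addrA; congr (m + _).
have -> : \sum_(j <- s) ((1 - l i)^-1 * l j) *: b j =
    (1 - l i)^-1 *: \sum_(j <- s) l j *: b j.
  by rewrite scaler_sumr; apply: eq_bigr => j _; rewrite scalerA.
rewrite [LHS]addrCA; congr (_ + _).
rewrite -[X in X - _]scale1r -scalerBl scalerA mulfV ?scale1r //.
by rewrite subr_eq0 gt_eqF.
Qed.

Lemma compact_exit (R : realType) (n : nat) (K : set 'rV[R]_n.+1) (x v : 'rV[R]_n.+1) :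
  compact K -> K x -> v != 0 ->
  exists t : R, [/\ 0 <= t, K (x + t *: v) & forall s, t < s -> ~ K (x + s *: v)].
Proof.
move=> cK Kx v0; have [M M0 KM] := compact_coord_bounded cK.
have clK : closed K by apply: compact_closed => //; exact: norm_hausdorff.
have /rV0Pn[i vi] := v0.
pose S : set R := [set t | 0 <= t /\ K (x + t *: v)].
have S0 : S 0 by split; rewrite // scale0r addr0.
have ubS : ubound S (2 * M / `|v 0 i|).
  move=> t [t0 Kt]; rewrite ler_pdivlMr ?normr_gt0 // -[X in X * _]ger0_norm // -normrM.
  have := KM _ i Kt; have := KM _ i Kx; rewrite !mxE => a b.
  rewrite (_ : t * v 0 i = (x 0 i + t * v 0 i) - x 0 i); last by ring.
  by apply: le_trans (ler_normB _ _) _; lra.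
have hsS : has_sup S by split; [exists 0|exists (2 * M / `|v 0 i|)].
exists (sup S); split.
- exact: (sup_upper_bound hsS).
- apply: contrapT => /(closedN_coord clK)[e e0 eK].
  pose L : R := 1 + \sum_j `|v 0 j|.
  have L0 : 0 < L by rewrite ltr_pwDl // sumr_ge0.
  have [t [t0 Kt] ts] := sup_adherent (divr_gt0 e0 L0) hsS.
  have tS : t <= sup S by apply: (sup_upper_bound hsS).
  apply: (eK _ _ Kt) => j; rewrite !mxE.
  rewrite (_ : _ - _ = (t - sup S) * v 0 j); last by ring.
  rewrite normrM (ler0_norm) ?subr_le0 // opprB.
  apply: (@le_lt_trans _ _ ((sup S - t) * L)).
    rewrite ler_wpM2l ?subr_ge0 // /L (bigD1 j) //= addrCA lerDl.
    by rewrite addr_ge0 // sumr_ge0.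
  by rewrite -ltr_pdivlMr //; lra.
- move=> s ts Ks; have : S s.
    split=> //; apply: le_trans (ltW ts); exact: (sup_upper_bound hsS).
  by move=> /(sup_upper_bound hsS); rewrite leNgt ts.
Qed.

Lemma exit_not_interior (R : realType) (n : nat) (K : set 'rV[R]_n.+1)
    (x v : 'rV[R]_n.+1) (t : R) :
  (forall s, t < s -> ~ K (x + s *: v)) -> ~ interior K (x + t *: v).
Proof.
move=> tK /nbhs_coord[e e0 eK].
have [L L0 vL] : exists2 L : R, 0 < L & forall j, `|v 0 j| <= L.
  exists (1 + \sum_j `|v 0 j|); first by rewrite ltr_pwDl // sumr_ge0.
  by move=> j; rewrite (bigD1 j) //= addrCA lerDl addr_ge0 // sumr_ge0.
have r0 : 0 < e / (2 * L) by rewrite divr_gt0 // mulr_gt0.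
apply: (tK (t + e / (2 * L))); first by rewrite ltrDl.
apply: eK => j; rewrite !mxE (_ : _ - _ = e / (2 * L) * v 0 j); last by ring.
rewrite normrM ger0_norm ?(ltW r0) //.
apply: (@le_lt_trans _ _ (e / (2 * L) * L)); first by rewrite ler_wpM2l // ltW.
rewrite (_ : _ * L = e / 2); first by lra.
by field; rewrite gt_eqF.
Qed.

Lemma segment_boundary (R : realType) (n : nat) (K : set 'rV[R]_n.+1) (x y : 'rV[R]_n.+1) :
  compact K -> convex_set K -> K x -> ~ K y ->
  exists t : R, [/\ 0 <= t < 1, K (x + t *: (y - x)), ~ interior K (x + t *: (y - x)) &
    forall s, t < s -> ~ K (x + s *: (y - x))].
Proof.
move=> cK vK Kx Ky.
have v0 : y - x != 0 by rewrite subr_eq0; apply: contra_notN Ky => /eqP ->.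
have [t [t0 Kt tK]] := compact_exit cK Kx v0.
exists t; split=> //; last exact: exit_not_interior.
rewrite t0 /= ltNge; apply/negP => t1; apply: Ky.
have ti : 0 <= t^-1 <= 1.
  by rewrite invr_ge0 t0 /= invf_le1 //; apply: lt_le_trans t1.
have := convex_set_segment vK Kx Kt ti; congr K.
rewrite [x + _ - x]addrAC subrr add0r scalerA mulVf ?scale1r; first by rewrite addrC subrK.
by rewrite gt_eqF //; apply: lt_le_trans t1.
Qed.

(** * Convex domains enclosed by a hypersurface *)

Lemma dotp_E_last (R : realType) (n : nat) (x : 'rV[R]_n.+1) :
  dotp x E_last = x 0 ord_max.
Proof.
rewrite /dotp (bigD1 ord_max) //= big1 ?addr0; first by rewrite mxE !eqxx mulr1.
by move=> i ni; rewrite mxE (negbTE ni) andbF mulr0.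
Qed.

Lemma interior_dense (R : realType) (n : nat) (K : set 'rV[R]_n.+1)
    (x : 'rV[R]_n.+1) (e : R) :
  closure (interior K) = K -> K x -> 0 < e ->
  exists2 q : 'rV[R]_n.+1, interior K q & forall i, `|q 0 i - x 0 i| < e.
Proof.
move=> clK; rewrite -[K in K x]clK => Kx e0.
have [|q [Kq qx]] := Kx [set q | forall i, `|q 0 i - x 0 i| < e].
  by apply/nbhs_coord; exists e.
by exists q.
Qed.

Lemma interior_last_gt0 (R : realType) (n : nat) (K : set 'rV[R]_n.+1)
    (q : 'rV[R]_n.+1) :
  K `<=` closed_half_space -> interior K q -> 0 < q 0 ord_max.
Proof.
move=> Kh /nbhs_coord[e e0 eK].
have : K (q - (e / 2) *: E_last).
  apply: eK => i; rewrite !mxE addrAC subrr add0r normrN normrM.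
  rewrite ger0_norm; last by rewrite divr_ge0 // ltW.
  apply: (@le_lt_trans _ _ (e / 2 * 1)); last by lra.
  by rewrite ler_wpM2l ?divr_ge0 ?(ltW e0) //; case: (_ && _); rewrite ?normr1 ?normr0.
move=> /Kh; rewrite /closed_half_space /= dotp_E_last !mxE !eqxx /= mulr1; lra.
Qed.

(** Away from [Sigma] the frontier of [K] lies in the hyperplane, hence it cannot separate
    two points of a small half-box resting on the hyperplane. *)
Lemma half_box_sub (R : realType) (n : nat) (Sigma K : set 'rV[R]_n.+1)
    (y : 'rV[R]_n.+1) :
  enclosed_domain Sigma K -> convex_set K -> closed Sigma ->
  K y -> y 0 ord_max = 0 -> ~ Sigma y ->
  exists2 e : R, 0 < e & forall z : 'rV[R]_n.+1,
    (forall i, `|z 0 i - y 0 i| < e) -> 0 <= z 0 ord_max -> K z.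
Proof.
move=> [cK Kh _ clK bdK] vK cS Ky y0 Sy.
have closedK : closed K by apply: compact_closed => //; exact: norm_hausdorff.
have [e e0 eS] := closedN_coord cS Sy.
have [q Kq qe] := @interior_dense _ _ _ _ e clK Ky e0.
have q0 := interior_last_gt0 Kh Kq.
have pos (z : 'rV[R]_n.+1) : (forall i, `|z 0 i - y 0 i| < e) -> 0 < z 0 ord_max -> K z.
  move=> ze z0; apply: contrapT => nKz.
  have [t [/andP[t0 t1] Kb nb _]] := segment_boundary cK vK (interior_subset Kq) nKz.
  set b := q + _ in Kb nb.
  have : (K `\` interior K) b by [].
  rewrite bdK => -[|[_]].
    apply: eS => i; rewrite /b !mxE.
    rewrite (_ : _ - y 0 i = (1 - t) * (q 0 i - y 0 i) + t * (z 0 i - y 0 i)); last by ring.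
    apply: le_lt_trans (ler_normD _ _) _; rewrite !normrM (ger0_norm t0).
    rewrite (@ger0_norm _ (1 - t)); last by lra.
    have := qe i; have := ze i; set a := `|_|; set c := `|_| => ae ce.
    have : 0 < (1 - t) * (e - c) by apply: mulr_gt0; lra.
    have : 0 <= t * (e - a) by apply: mulr_ge0; lra.
    by nra.
  rewrite /half_space_boundary /= dotp_E_last /b !mxE.
  have : 0 < (1 - t) * q 0 ord_max by apply: mulr_gt0; lra.
  have : 0 <= t * z 0 ord_max by apply: mulr_ge0; lra.
  by nra.
exists e => // z ze; rewrite le_eqVlt => /orP[/eqP z0|]; last exact: pos.
apply: contrapT => /(closedN_coord closedK)[d d0 dK].
have m0 : 0 < Num.min d e by rewrite lt_min d0.
apply: (dK (z + (Num.min d e / 2) *: E_last)).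
  move=> i; rewrite !mxE addrAC subrr add0r normrM ger0_norm; last by lra.
  apply: (@le_lt_trans _ _ (Num.min d e / 2 * 1)).
    by rewrite ler_wpM2l; [|lra|case: (_ && _); rewrite ?normr1 ?normr0].
  have md : Num.min d e <= d by rewrite ge_min lexx.
  by lra.
have me : Num.min d e <= e by rewrite ge_min lexx orbT.
apply: pos => [i|]; rewrite !mxE; last by rewrite -z0 !eqxx /= mulr1; lra.
have [->|ni] := eqVneq i ord_max; last by rewrite andbF mulr0 addr0.
rewrite -z0 y0 ?eqxx /= mulr1 add0r subr0 ger0_norm; lra.
Qed.

(** The last point of [K] on the ray is on [Sigma] or in the hyperplane; in the latter case
    [half_box_sub] would allow to continue within [K], as the ray does not descend. *)
Lemma exit_through (R : realType) (n : nat) (Sigma K : set 'rV[R]_n.+1)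
    (x : 'rV[R]_n.+1) (i : 'I_n.+1) :
  enclosed_domain Sigma K -> convex_set K -> closed Sigma -> K x ->
  exists t : R, [/\ 0 <= t, K (x + t *: delta_mx 0 i) & Sigma (x + t *: delta_mx 0 i)].
Proof.
move=> dom vK cS Kx; case: (dom) => cK Kh _ clK bdK.
have d0 : delta_mx 0 i != 0 :> 'rV[R]_n.+1.
  by apply/rV0Pn; exists i; rewrite mxE !eqxx oner_eq0.
have [t [t0 Kt tK]] := compact_exit cK Kx d0.
exists t; split=> //; apply: contrapT => nS.
have : (K `\` interior K) (x + t *: delta_mx 0 i).
  by split=> //; exact: exit_not_interior.
rewrite bdK => -[//|[_]]; rewrite /half_space_boundary /= dotp_E_last => y0.
have [e e0 eK] := half_box_sub dom vK cS Kt y0 nS.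
apply: (tK (t + e / 2)); first by rewrite ltrDl divr_gt0.
rewrite scalerDl addrA; set y := x + _ in y0 eK *.
have yE j : (y + (e / 2) *: delta_mx 0 i) 0 j = y 0 j + e / 2 * (j == i)%:R.
  by rewrite [LHS]mxE [X in _ + X]mxE [X in _ * X]mxE eqxx.
apply: eK => [j|]; rewrite yE; last first.
  by rewrite y0 add0r mulr_ge0 ?divr_ge0 ?(ltW e0) // ler0n.
rewrite addrAC subrr add0r normrM ger0_norm; last by lra.
apply: (@le_lt_trans _ _ (e / 2 * 1)); last by lra.
by rewrite ler_wpM2l; [|lra|case: (_ == _); rewrite ?normr1 ?normr0].
Qed.

(** * Area of a surface met by all coordinate rays *)

(** Each member of a cover of [S], extended by [l] backwards along the [i]-th axis, still
    lies in a box; together these boxes cover [K]. *)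
Lemma volume_le_chord_area (R : realType) (n : nat) (w l A : R)
    (S K : set 'rV[R]_n.+1) (i : 'I_n.+1) :
  0 < w -> lebesgue_outer (@unit_ball R n) = w%:E -> 0 < l ->
  (hausdorff n S < A%:E)%E ->
  (forall x, K x -> exists2 t, 0 <= t <= l & S (x + t *: delta_mx 0 i)) ->
  (lebesgue_outer K <= (3 * 2 ^+ n * (2 ^+ n / w) * A * l)%:E)%E.
Proof.
move=> w0 Ew l0 SA KS.
have [u [d [dl Sd sumd]]] := hausdorff_cube_cover w0 Ew l0 SA.
pose a k j := u k 0 j - d k - (if j == i then l else 0).
pose b k j := u k 0 j + d k.
apply: (@le_trans _ _ (\sum_(0 <= k <oo) (\prod_j (b k j - a k j))%:E)%E).
  apply: lebesgue_outer_le => [k j|x /KS[t /andP[t0 tl] /Sd[k kx]]].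
    by have /andP[d0 _] := dl k; rewrite /a /b; case: ifP => _; lra.
  exists k => j; have := kx j; rewrite !mxE eqxx /= /a /b ler_norml => /andP[].
  case: (j == i); rewrite ?mulr1 ?mulr0 => h1 h2; apply/andP; split; lra.
apply: (@le_trans _ _ (\sum_(0 <= k <oo) (3 * l * 2 ^+ n)%:E * (d k ^+ n)%:E)%E).
  apply: lee_nneseries => [k _ _|k _].
    rewrite lee_fin prodr_ge0 // => j _; rewrite /a /b.
    by have /andP[d0 _] := dl k; case: ifP => _; lra.
  have /andP[d0 dkl] := dl k.
  rewrite -EFinM lee_fin (bigD1 i) //= {1}/a {1}/b eqxx.
  rewrite (eq_bigr (fun=> 2 * d k)); last first.
    by move=> j /negbTE ji; rewrite /a /b ji; ring.
  rewrite prodr_const cardC1 card_ord exprMn /= -[leRHS]mulrA.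
  by apply: ler_wpM2r; [rewrite mulr_ge0 ?exprn_ge0|lra].
rewrite nneseriesZl; last by move=> k _; rewrite lee_fin exprn_ge0 //; case/andP: (dl k).
apply: le_trans (lee_wpmul2l _ sumd) _.
  by rewrite lee_fin !mulr_ge0 ?exprn_ge0 // ltW.
by rewrite -EFinM lee_fin le_eqVlt; apply/orP; left; apply/eqP; ring.
Qed.

(** The projection of [S] along the [i]-th axis covers that of a tube of length [tau1 - tau0]
    and of half-width [s] around a curve parametrized by its [j]-th coordinate; the volume of
    the tube is found by integrating last along the [j]-th axis. *)
Lemma area_ge_tube (R : realType) (n : nat) (w A tau0 tau1 s : R)
    (S : set 'rV[R]_n.+1) (i j : 'I_n.+1) (c : R -> 'rV[R]_n.+1) :
  (0 < n)%N -> 0 < w -> lebesgue_outer (@unit_ball R n) = w%:E ->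
  (hausdorff n S < A%:E)%E -> i != j -> tau0 <= tau1 -> 0 <= s ->
  (forall tau (x : 'rV[R]_n.+1), tau0 <= tau <= tau1 -> x 0 j = tau ->
     (forall k, k != j -> `|x 0 k - c tau 0 k| <= s) ->
     exists t, S (x + t *: delta_mx 0 i)) ->
  (2 * s) ^+ n.-1 * (tau1 - tau0) <= 2 ^+ n * (2 ^+ n / w) * A.
Proof.
move=> n0 w0 Ew SA ij tau01 s0 tubeS.
have [u [d [d01 Sd sumd]]] := hausdorff_cube_cover w0 Ew ltr01 SA.
have d0 k : 0 <= d k by case/andP: (d01 k).
pose r := [seq k <- index_enum 'I_n.+1 | (k != j) && (k != i)].
have ur : uniq r by rewrite filter_uniq // index_enum_uniq.
have sr (v : R) : \prod_(k <- r) v = v ^+ n.-1.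
  rewrite big_filter prodr_const; congr (_ ^+ _).
  have := cardC (mem [:: i; j]); rewrite card_ord.
  have -> : #|mem [:: i; j]| = 2%N by apply/card_uniqP; rewrite /= inE ij.
  have e k : (2 + k = n.+1 -> n.-1 = k)%N by rewrite add2n => -[<-].
  by move/e => ->; apply: eq_card => k; rewrite !inE negb_or andbC.
rewrite -lee_fin.
apply: (@le_trans _ _
  (\sum_(0 <= k <oo) ((2 * d k) ^+ n.-1 * ((u k 0 j + d k) - (u k 0 j - d k)))%:E)%E).
  apply: weighted_cover_itv => // [k|k|tau tau_in].
  - by rewrite exprn_ge0 // mulr_ge0.
  - by have := d0 k; lra.
  pose p k := c tau 0 k - s; pose q k := c tau 0 k + s.
  pose a m k := u m 0 k - d m; pose b m k := u m 0 k + d m.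
  have := @weighted_cover_box R _ r 1 (fun m => (a m j <= tau <= b m j)%R%:R) p q a b ur.
  rewrite mul1r (eq_bigr (fun=> 2 * s)); last by move=> k _; rewrite /p /q; ring.
  rewrite sr => /(_ _ _ _ _)/le_trans; apply.
  - by move=> k; rewrite /p /q; lra.
  - by move=> k.
  - by move=> m k; rewrite /a /b; have := d0 m; lra.
  - move=> y yr; pose x : 'rV[R]_n.+1 :=
      \row_k (if k == j then tau else if k == i then c tau 0 i else y k).
    have [||t /Sd[m mx]] := tubeS tau x tau_in.
    + by rewrite mxE eqxx.
    + move=> k kj; rewrite mxE (negbTE kj); case: eqVneq => [->|ki].
        by rewrite subrr normr0.
      have := yr k; rewrite mem_filter kj ki mem_index_enum => /(_ isT).
      by rewrite /p /q ler_norml => /andP[? ?]; apply/andP; split; lra.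
    have xc k : k != i -> a m k <= x 0 k <= b m k.
      move=> ki; have := mx k; rewrite !mxE (negbTE ki) andbF mulr0 addr0 ler_norml.
      by rewrite /a /b => /andP[? ?]; apply/andP; split; lra.
    apply: le_trans (nneseries_ge_term m _); last first.
      by move=> m'; rewrite lee_fin mulr_ge0 // prodr_ge0.
    have := xc j; rewrite eq_sym ij mxE eqxx => /(_ isT) ->.
    rewrite mul1r lee_fin big_seq big1 // => k.
    rewrite mem_filter => /andP[/andP[kj ki] _].
    by have := xc k ki; rewrite mxE (negbTE kj) (negbTE ki) => ->.
  - apply: lee_nneseries => [m _ _|m _].
      rewrite lee_fin mulr_ge0 // prodr_ge0 // => k _.
      by rewrite /a /b; have := d0 m; lra.
    rewrite (eq_bigr (fun=> 2 * d m)); last by move=> k _; rewrite /a /b; ring.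
    by rewrite sr mulrC.
rewrite (eq_eseriesr (g := fun k => (2 ^+ n)%:E * (d k ^+ n)%:E)%E); last first.
  move=> k _; rewrite -EFinM; congr EFin.
  rewrite -exprMn -[in RHS](prednK n0) exprSr; congr (_ * _); ring.
rewrite nneseriesZl; last by move=> k _; rewrite lee_fin exprn_ge0.
rewrite -mulrA [leRHS]EFinM; by apply: lee_wpmul2l.
Qed.

(** * First-order expansion of charts *)

Lemma mvt_origin (R : realType) (g dg : R -> R) (t : R) :
  (forall z : R, `|z| <= `|t| -> is_derive z 1 g (dg z)) ->
  exists2 z, `|z| <= `|t| & g t - g 0 = t * dg z.
Proof.
move=> gD.
have in_cont a b : (forall z, a <= z <= b -> `|z| <= `|t|) -> {within `[a, b], continuous g}.
  move=> ab; apply: derivable_within_continuous => z; rewrite in_itv /= => /ab/gD.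
  by case.
have [t0|t0] := leP 0 t.
  have le_t z : 0 <= z <= t -> `|z| <= `|t|.
    by move=> /andP[z0 zt]; rewrite !ger0_norm.
  have [|z zin E] := @MVT_segment R g dg _ _ t0 _ (in_cont _ _ le_t).
    by move=> z; rewrite in_itv /= => /andP[z0 zt]; apply/gD/le_t; rewrite !ltW.
  exists z; last by rewrite E subr0 mulrC.
  by apply: le_t; move: zin; rewrite in_itv.
have le_t z : t <= z <= 0 -> `|z| <= `|t|.
  by move=> /andP[zt z0]; rewrite !ler0_norm ?lerN2 // ltW.
have [|z zin E] := @MVT_segment R g dg _ _ (ltW t0) _ (in_cont _ _ le_t).
  by move=> z; rewrite in_itv /= => /andP[z0 zt]; apply/gD/le_t; rewrite !ltW.
exists z; first by apply: le_t; move: zin; rewrite in_itv.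
by rewrite -opprB E sub0r mulrN opprK mulrC.
Qed.

Lemma is_derive_line (R : realType) (m p : nat) (f : 'rV[R]_m.+1 -> 'rV[R]_p.+1)
    (y v : 'rV[R]_m.+1) (c : 'I_p.+1) (t : R) :
  derivable f (y + t *: v) v ->
  is_derive t 1 (fun z : R => f (y + z *: v) 0 c) (('D_v f (y + t *: v)) 0 c).
Proof.
move=> df; have dG : derivable (fun x => f x 0 c) (y + t *: v) v.
  by move/derivable_mxP : df; exact.
rewrite (derive_mx df) mxE.
have E : (fun h : R => h^-1 *: (((fun z => f (y + z *: v) 0 c) \o shift t) (h *: 1) -
                                f (y + t *: v) 0 c)) =
         (fun h : R => h^-1 *: (((fun x => f x 0 c) \o shift (y + t *: v)) (h *: v) -
                                f (y + t *: v) 0 c)).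
  apply/funext => h /=; congr (_ *: (f _ 0 c - _)).
  by rewrite (_ : h%:A = h); [rewrite scalerDl addrCA|exact: mulr1].
by split; rewrite /derivable /derive E.
Qed.

(** Continuous partial derivatives give a first-order expansion, by applying the mean value
    theorem to one coordinate at a time. *)
Lemma smooth_expansion (R : realType) (m p : nat) (D : set 'rV[R]_m.+1)
    (f : 'rV[R]_m.+1 -> 'rV[R]_p.+1) (x : 'rV[R]_m.+1) (c : 'I_p.+1) (e : R) :
  open D -> smooth_on D f -> D x -> 0 < e ->
  exists2 d : R, 0 < d & forall h : 'rV[R]_m.+1, (forall i, `|h 0 i| < d) ->
    `|f (x + h) 0 c - f x 0 c - \sum_i h 0 i * ('D_(delta_mx 0 i) f x) 0 c|
      <= e * \sum_i `|h 0 i|.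
Proof.
move=> oD sf Dx e0; pose df (i : 'I_m.+1) (y : 'rV[R]_m.+1) : R := ('D_(delta_mx 0 i) f y) 0 c.
have : \forall y \near x, D y /\ forall i : 'I_m.+1, `|df i x - df i y| < e.
  apply: filterI; first exact: open_nbhs_nbhs.
  apply: (@filter_forall _ _ (fun i y => `|df i x - df i y| < e) (nbhs x)) => i.
  have [cont _] := sf [:: i] x Dx.
  have cdf : {for x, continuous (df i)}.
    exact: (continuous_comp cont (@coord_continuous _ _ _ 0 c _)).
  by move/cvgrPdist_lt : cdf => /(_ e e0).
move=> /nbhs_coord[d d0 xd]; exists d => // h hd.
pose y k : 'rV[R]_m.+1 := \row_i (x 0 i + (if (i < k)%N then h 0 i else 0)).
have -> : x = y 0%N by apply/rowP => i; rewrite mxE addr0.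
have -> : y 0%N + h = y m.+1 by apply/rowP => i; rewrite !mxE ltn_ord addr0.
have := telescope_sumr (fun k => f (y k) 0 c) (leq0n m.+1) => <-.
rewrite big_mkord -sumrB mulr_sumr; apply: le_trans (ler_norm_sum _ _ _) _.
apply: ler_sum => i _.
have yS : y i.+1 = y i + h 0 i *: delta_mx 0 i.
  apply/rowP => j; rewrite !mxE eqxx /= ltnS leq_eqVlt.
  have [->|ji] := eqVneq j i; first by rewrite eqxx ltnn mulr1 addr0.
  by rewrite (_ : (_ == _ :> nat) = false) ?mulr0 ?addr0 //; apply: negbTE.
have y0 : y 0%N = x by apply/rowP => j; rewrite mxE addr0.
have yin z : `|z| <= `|h 0 i| ->
    forall j, `|(y i + z *: delta_mx 0 i) 0 j - x 0 j| < d.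
  move=> zh j; rewrite !mxE eqxx /=; have [->|ji] := eqVneq j i.
    rewrite ltnn mulr1 addr0 addrAC subrr add0r; exact: le_lt_trans zh (hd i).
  rewrite mulr0 addr0 addrAC subrr add0r; case: ifP => _ //.
  by rewrite normr0.
have [z zh] := @mvt_origin R (fun z => f (y i + z *: delta_mx 0 i) 0 c)
   (fun z => df i (y i + z *: delta_mx 0 i)) (h 0 i)
   (fun z zh => is_derive_line _ ((sf [::] _ (proj1 (xd _ (yin z zh)))).2 i)).
rewrite -yS scale0r addr0 => ->; rewrite -mulrBr normrM mulrC.
apply: ler_wpM2r => //; rewrite y0 distrC ltW //.
by case: (xd _ (yin z zh)) => _; exact.
Qed.

Lemma smooth_derive (R : realType) (m p : nat) (D : set 'rV[R]_m.+1)
    (f : 'rV[R]_m.+1 -> 'rV[R]_p.+1) (x v : 'rV[R]_m.+1) (c : 'I_p.+1) :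
  open D -> smooth_on D f -> D x ->
  ('D_v f x) 0 c = \sum_i v 0 i * ('D_(delta_mx 0 i) f x) 0 c.
Proof.
move=> oD sf Dx.
pose L c := \sum_i v 0 i * ('D_(delta_mx 0 i) f x) 0 c.
have cv c' : h^-1 *: (((fun x => f x 0 c') \o shift x) (h *: v) - f x 0 c')
    @[h --> (0:R)^'] --> L c'.
  apply/cvgrPdist_le => e e0.
  pose V := 1 + \sum_i `|v 0 i|.
  have V0 : 0 < V by rewrite ltr_pwDl // sumr_ge0.
  have [d d0 Hd] := smooth_expansion c' oD sf Dx (divr_gt0 e0 V0).
  near=> h; have h0 : h != 0 by near: h; exact: nbhs_dnbhs_neq.
  have hd i : `|(h *: v) 0 i| < d.
    rewrite mxE normrM; apply: (@le_lt_trans _ _ (`|h| * V)).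
      by rewrite ler_wpM2l // /V (bigD1 i) //= addrCA lerDl addr_ge0 // sumr_ge0.
    rewrite -ltr_pdivlMr //; near: h; apply: dnbhs0_lt; exact: divr_gt0.
  have := Hd _ hd; rewrite /= [h *: v + x]addrC.
  have -> : \sum_i (h *: v) 0 i * ('D_(delta_mx 0 i) f x) 0 c' = h * L c'.
    by rewrite mulr_sumr; apply: eq_bigr => i _; rewrite mxE mulrA.
  have -> : \sum_i `|(h *: v) 0 i| = `|h| * (V - 1).
    rewrite /V addrAC subrr add0r mulr_sumr.
    by apply: eq_bigr => i _; rewrite mxE normrM.
  set F := _ - f x 0 c' => FL.
  have -> : L c' - h^-1 *: F = - (h^-1 * (F - h * L c')).
    by rewrite mulrBr mulrA mulVf // mul1r opprB.
  rewrite normrN normrM normfV ler_pdivrMl ?normr_gt0 //.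
  apply: (le_trans FL); rewrite mulrCA ler_wpM2l //.
  by rewrite mulrAC ler_pdivrMr // ler_wpM2l ?gerBl // ltW.
have df c' : derivable (fun x => f x 0 c') x v by apply/cvg_ex; exists (L c'); exact: cv.
rewrite derive_mx; last by apply/derivable_mxP => i j; rewrite ord1.
by rewrite mxE; exact: cvg_lim (cv c).
Unshelve. all: by end_near.
Qed.

(** * Supporting half-spaces *)

Lemma dotpC (R : realType) (m : nat) (u v : 'rV[R]_m) : dotp u v = dotp v u.
Proof. by apply: eq_bigr => i _; rewrite mulrC. Qed.

Lemma dotpDl (R : realType) (m : nat) (u v w : 'rV[R]_m) :
  dotp (u + v) w = dotp u w + dotp v w.
Proof. by rewrite -big_split; apply: eq_bigr => i _; rewrite mxE mulrDl. Qed.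

Lemma dotpZl (R : realType) (m : nat) (a : R) (u v : 'rV[R]_m) :
  dotp (a *: u) v = a * dotp u v.
Proof. by rewrite mulr_sumr; apply: eq_bigr => i _; rewrite mxE mulrA. Qed.

Lemma dotpBl (R : realType) (m : nat) (u v w : 'rV[R]_m) :
  dotp (u - v) w = dotp u w - dotp v w.
Proof. by rewrite -scaleN1r dotpDl dotpZl mulN1r. Qed.

Lemma dotp_ge0 (R : realType) (m : nat) (u : 'rV[R]_m) : 0 <= dotp u u.
Proof. by apply: sumr_ge0 => i _; rewrite -expr2 sqr_ge0. Qed.

Lemma dotp_eq0 (R : realType) (m : nat) (u : 'rV[R]_m) : dotp u u = 0 -> u = 0.
Proof.
move/eqP; rewrite psumr_eq0 => [|i _]; last by rewrite -expr2 sqr_ge0.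
move=> /allP u0; apply/rowP => i; rewrite mxE; apply/eqP.
by have := u0 i (mem_index_enum _); rewrite mulf_eq0 orbb.
Qed.

Lemma enorm1_dotp (R : realType) (m : nat) (u : 'rV[R]_m) :
  enorm u = 1 -> dotp u u = 1.
Proof. by move=> u1; rewrite -(sqr_sqrtr (dotp_ge0 u)) -/(enorm u) u1 expr1n. Qed.

(** Subtracting from [N] its component along [l] leaves a vector in the kernel of [l], which is
    orthogonal to [N] as well as to [l], hence to itself. *)
Lemma normal_proportional (R : realType) (m : nat) (N l : 'rV[R]_m) :
  dotp N N = 1 -> (forall v, dotp v l = 0 -> dotp N v = 0) ->
  exists2 c, c != 0 & l = c *: N.
Proof.
move=> N1 Nl; set b := dotp l l; set a := dotp N l.
have [b0|b0] := eqVneq b 0.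
  have l0 := dotp_eq0 b0; have := Nl N; rewrite N1 l0.
  rewrite /dotp big1 => [/(_ erefl)/eqP|i _]; first by rewrite oner_eq0.
  by rewrite mxE mulr0.
pose v := N - (a / b) *: l.
have vl : dotp v l = 0 by rewrite /v dotpBl dotpZl -/a -/b divfK // subrr.
have vN : dotp v N = 0 by rewrite dotpC Nl.
have vv : dotp v v = 0.
  by rewrite {1}/v dotpBl dotpZl ![dotp _ v]dotpC vl vN mulr0 subrr.
have Nal : N = (a / b) *: l by apply/eqP; rewrite -subr_eq0 -/v (dotp_eq0 vv).
have a0 : a != 0.
  apply: contra_eqN (N1) => /eqP a0; rewrite Nal a0 mul0r scale0r.
  by rewrite /dotp big1 1?eq_sym ?oner_neq0 // => i _; rewrite mxE mul0r.
exists (b / a); first by rewrite mulf_neq0 // invr_eq0.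
by rewrite Nal scalerA mulrA divfK // mulfV // scale1r.
Qed.

(** Near [z] the hypersurface is a level set of a function whose gradient is a nonzero multiple
    of the normal [N]. Were [w] on the outer side of the tangent plane, the short segment
    from [z + t (w - z)], which is in [K], to [z + t N], which is not, would cross
    [Sigma]; but along it that function is of order [t]. *)
Lemma tangent_plane_support (R : realType) (n : nat) (Sigma K : set 'rV[R]_n.+1)
    (z N w : 'rV[R]_n.+1) :
  enclosed_domain Sigma K -> convex_set K -> hs_interior Sigma z ->
  0 < z 0 ord_max -> dotp N N = 1 ->
  (forall v, tangent Sigma z v -> dotp N v = 0) ->
  (\forall t \near (0 : R)^'+, ~ K (z + t *: N) /\ K (z - t *: N)) ->
  K w -> dotp (w - z) N <= 0.
Proof.
move=> [cK Kh _ clK bdK] vK [Sz [phi chart]] z0 N1 Ntan Nout Kw.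
rewrite leNgt; apply/negP => eta0; set eta := dotp _ _ in eta0.
have [U [Uz [oU sU _] SU]] := chart.
pose l : 'rV[R]_n.+1 := \row_i ('D_(delta_mx 0 i) phi z) 0 ord_max.
have [c c0 lN] : exists2 c, c != 0 & l = c *: N.
  apply: normal_proportional => // v vl; apply: Ntan.
  exists phi; split; first by left.
  rewrite (smooth_derive v ord_max oU sU Uz) -[RHS]vl.
  by apply: eq_bigr => i _; rewrite mxE.
have Kz : K z.
  by have : (K `\` interior K) z; [rewrite bdK; left|case].
pose M := 1 + \sum_i (`|N 0 i| + `|w 0 i - z 0 i|).
have s0 : 0 <= \sum_i (`|N 0 i| + `|w 0 i - z 0 i|).
  by apply: sumr_ge0 => i _; rewrite addr_ge0.
have M0 : 0 < M by rewrite /M; lra.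
have iM i : `|N 0 i| + `|w 0 i - z 0 i| <= M.
  by rewrite /M (bigD1 i) //= addrCA lerDl addr_ge0 // sumr_ge0.
pose mu := Num.min 1 eta.
have mu0 : 0 < mu by rewrite /mu lt_min ltr01.
have mu1 : mu <= 1 by rewrite ge_min lexx.
have mue : mu <= eta by rewrite ge_min lexx orbT.
have ac0 : 0 < `|c| by rewrite normr_gt0.
have e0 : 0 < `|c| * mu / (2 * M) by rewrite !divr_gt0 ?mulr_gt0.
have [d d0 Hd] := smooth_expansion ord_max oU sU Uz e0.
have [d' d'0 Hd'] : exists2 d : R, 0 < d & forall y : 'rV[R]_n.+1,
    (forall i, `|y 0 i - z 0 i| < d) -> U y.
  by apply/nbhs_coord; exact: open_nbhs_nbhs.
have [t [[t0 t1 td td' tz] Kt]] : exists t : R,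
    [/\ 0 < t, t < 1, t < d / M, t < d' / M & t < z 0 ord_max / M] /\ ~ K (z + t *: N).
  near (0:R)^'+ => t; exists t; split; last first.
    by have [] : ~ K (z + t *: N) /\ K (z - t *: N) by near: t.
  split; near: t; [exact: nbhs_right_gt|exact: nbhs_right_lt|exact/nbhs_right_lt/divr_gt0..].
have tw : K (z + t *: (w - z)) by apply: convex_set_segment; rewrite // !ltW.
have [s [/andP[s0' s1] Kb nb _]] := segment_boundary cK vK tw Kt.
set b := _ + s *: _ in Kb nb.
pose h := b - z.
have hE : h = t *: ((1 - s) *: (w - z) + s *: N).
  by apply/rowP => i; rewrite /h /b !mxE; ring.
have hM i : `|h 0 i| <= t * M.
  rewrite hE !mxE normrM gtr0_norm // ler_pM2l //.
  apply: le_trans (ler_normD _ _) _; rewrite !normrM (ger0_norm s0').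
  rewrite (@ger0_norm _ (1 - s)); last by lra.
  have := iM i; have := normr_ge0 (N 0 i); have := normr_ge0 (w 0 i - z 0 i).
  set p := `|_|; set q := `|_| => p0 q0 pq.
  have : 0 <= s * p by rewrite mulr_ge0.
  have : 0 <= (1 - s) * q by rewrite mulr_ge0 //; lra.
  by nra.
have bz : b = z + h by rewrite /h addrC subrK.
have Sb : Sigma b.
  have : (K `\` interior K) b by [].
  rewrite bdK => -[//|[_]]; rewrite /half_space_boundary /= dotp_E_last bz mxE => b0.
  have := hM ord_max; rewrite (_ : h 0 ord_max = - z 0 ord_max); last by lra.
  by rewrite normrN gtr0_norm // leNgt -ltr_pdivlMr // tz.
have Ub : U b.
  apply: Hd' => i; have := hM i; rewrite /h !mxE => /le_lt_trans; apply.
  by rewrite -ltr_pdivlMr.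
have /SU Fb := Ub; have /SU Fz := Uz.
have hd i : `|h 0 i| < d by apply: le_lt_trans (hM i) _; rewrite -ltr_pdivlMr.
have := Hd h hd; rewrite -bz (proj1 Fb Sb) (proj1 Fz Sz) subrr sub0r normrN.
have -> : \sum_i h 0 i * ('D_(delta_mx 0 i) phi z) 0 ord_max = c * (t * ((1 - s) * eta + s)).
  transitivity (dotp h l); first by apply: eq_bigr => i _; rewrite !mxE.
  rewrite lN dotpC dotpZl dotpC hE dotpZl dotpDl !dotpZl -/eta N1; ring.
have : \sum_i `|h 0 i| <= t * M.
  have -> : t * M = t + \sum_i t * (`|N 0 i| + `|w 0 i - z 0 i|).
    by rewrite /M mulrDr mulr1 mulr_sumr.
  apply: (@le_trans _ _ (\sum_i t * (`|N 0 i| + `|w 0 i - z 0 i|))); last by rewrite lerDr ltW.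
  apply: ler_sum => i _; rewrite hE !mxE normrM gtr0_norm // ler_pM2l //.
  apply: le_trans (ler_normD _ _) _; rewrite !normrM (ger0_norm s0').
  rewrite (@ger0_norm _ (1 - s)); last by lra.
  have := normr_ge0 (N 0 i); have := normr_ge0 (w 0 i - z 0 i).
  by nra.
set Q := \sum_i _ => QM.
rewrite !normrM (gtr0_norm t0) => /le_trans/(_ (ler_wpM2l (ltW e0) QM)).
rewrite (_ : `|c| * mu / (2 * M) * (t * M) = `|c| * (t * (mu / 2))); last first.
  by field; rewrite gt_eqF.
rewrite ler_pM2l // ler_pM2l // => /(le_trans (ler_norm _)).
have : 0 <= (1 - s) * (eta - mu) by apply: mulr_ge0; lra.
have : 0 <= s * (1 - mu) by apply: mulr_ge0; lra.
by nra.
Unshelve. all: by end_near. Qed.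

(** * The domain lies above its base *)

Lemma le0_small (R : realType) (a C : R) :
  0 <= C -> (forall e, 0 < e -> a <= e * C) -> a <= 0.
Proof.
move=> C0 aC; rewrite leNgt; apply/negP => a0.
have C1 : 0 < C + 1 by lra.
have e0 : 0 < a / (2 * (C + 1)) by rewrite divr_gt0 // mulr_gt0.
have := aC _ e0; rewrite mulrAC ler_pdivlMr ?mulr_gt0 //.
have : 0 < a * C + 2 * a by rewrite ltr_wpDl ?mulr_gt0 // mulr_ge0 // ltW.
by nra.
Qed.

Lemma dotp_le_coord (R : realType) (m : nat) (u v : 'rV[R]_m) (r : R) :
  (forall i, `|v 0 i| <= r) -> `|dotp u v| <= r * \sum_i `|u 0 i|.
Proof.
move=> vr; apply: le_trans (ler_norm_sum _ _ _) _; rewrite mulr_sumr.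
by apply: ler_sum => i _; rewrite normrM mulrC ler_wpM2r.
Qed.

Lemma within_continuous_coord (R : realType) (n : nat) (A : set 'rV[R]_n.+1)
    (f : 'rV[R]_n.+1 -> 'rV[R]_n.+1) (p : 'rV[R]_n.+1) (e : R) :
  {within A, continuous f} -> A p -> 0 < e ->
  exists2 d : R, 0 < d & forall z : 'rV[R]_n.+1,
    (forall i, `|z 0 i - p 0 i| < d) -> A z -> forall i, `|f z 0 i - f p 0 i| < e.
Proof.
move=> /subspace_continuousP/[apply] cf e0.
have /cf : nbhs (f p) [set y | forall i, `|y 0 i - f p 0 i| < e].
  by apply/nbhs_coord; exists e.
by move=> /nbhs_coord[d d0 H]; exists d.
Qed.

(** If some projection is not in [K], there is also an interior point [q] of [K] whose projection
    [x'] is not in [K]. Moving from the base towards [x'], let [p] be the last point in [K] and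
    [mu = x' - p]. Above [p + r mu], which is not in [K], lies [p + r (q - p)], which is; below
    the latter there is a lowest point [z] of [K]. It is on [Sigma] and its normal does not point
    upwards; as [p] is in [K], this normal makes no obtuse angle with [mu]. When [r] tends to 0,
    the normal [N] at [p] is seen to satisfy [dotp mu N >= 0] and to support [K]. Since its last
    coordinate is [cos theta >= 0], it follows that [dotp (q - p) N >= 0], which is absurd as [q]
    is interior. *)
Lemma capillary_projection (R : realType) (n : nat) (theta : R)
    (Sigma K : set 'rV[R]_n.+1) (x : 'rV[R]_n.+1) :
  0 <= cos theta -> capillary_hypersurface theta Sigma K -> convex_set K ->
  K x -> K (x - x 0 ord_max *: E_last).
Proof.
move=> cos0 cap vK Kx0.
have dom := cap_enclosed cap; case: (dom) => cK Kh _ clK bdK.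
have closedK : closed K by apply: compact_closed => //; exact: norm_hausdorff.
have closedS : closed Sigma.
  by apply: compact_closed; [exact: norm_hausdorff|exact: cap_compact cap].
have SK z : Sigma z -> K z.
  by move=> Sz; have : (K `\` interior K) z; [rewrite bdK; left|case].
have Klast z : K z -> 0 <= z 0 ord_max.
  by move=> /Kh; rewrite /closed_half_space /= dotp_E_last.
apply: contrapT => /(closedN_coord closedK)[e e0 eK].
have [q Kq qx] := @interior_dense _ _ _ _ e clK Kx0 e0.
have [x' x'E] : {x' : 'rV[R]_n.+1 | x' = q - q 0 ord_max *: E_last} by eexists.
have nKx' : ~ K x'.
  apply: eK => i; rewrite x'E !mxE eqxx /=.
  have [->|_] := eqVneq i ord_max; first by rewrite !mulr1 !subrr normr0.
  by rewrite !mulr0 !subr0.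
have x'0 : x' 0 ord_max = 0 by rewrite x'E !mxE !eqxx mulr1 subrr.
pose h := q 0 ord_max.
have [e1 e10 qK] : exists2 d : R, 0 < d & forall y : 'rV[R]_n.+1,
    (forall i, `|y 0 i - q 0 i| < d) -> K y by apply/nbhs_coord.
have [p0 bdp0] := cap_bd_nonempty cap.
have p00 : p0 0 ord_max = 0.
  by have := cap_bd cap bdp0; rewrite /half_space_boundary /= dotp_E_last.
have Kp0 : K p0 by apply: SK; case: bdp0.
have [T [/andP[T0 T1] Kp _ Tout]] := segment_boundary cK vK Kp0 nKx'.
have [p pE] : {p : 'rV[R]_n.+1 | p = p0 + T *: (x' - p0)} by eexists.
rewrite -pE in Kp; have [mu muD] : {mu : 'rV[R]_n.+1 | mu = x' - p} by eexists.
have p_last : p 0 ord_max = 0 by rewrite pE !mxE x'0 p00; ring.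
have mu_last : mu 0 ord_max = 0 by rewrite muD !mxE x'0 p_last subrr.
have muE : mu = (1 - T) *: (x' - p0) by apply/rowP => i; rewrite muD pE !mxE; ring.
have muout r : 0 < r -> ~ K (p + r *: mu).
  move=> r0; rewrite muE scalerA pE -addrA -scalerDl; apply: Tout.
  by rewrite ltrDl mulr_gt0 // subr_gt0.
have qE : q = p + mu + h *: E_last.
  by apply/rowP => i; rewrite muD x'E !mxE /h; ring.
have h2K : K (q - (e1 / 2) *: E_last).
  apply: qK => i; rewrite !mxE eqxx /= addrAC subrr add0r normrN normrM.
  rewrite ger0_norm; last by lra.
  apply: (@le_lt_trans _ _ (e1 / 2 * 1)); last by lra.
  by rewrite ler_wpM2l; [|lra|case: (_ == _); rewrite ?normr1 ?normr0].
have h0 : 0 <= h - e1 / 2.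
  by have := Klast _ h2K; rewrite !mxE !eqxx mulr1.
have [nu [[nuC nu1 nuT nuO] nuE]] := cap_angle cap.
(* The upper point is taken on the segment from [p] to [q - (e1 / 2) E], so that the point of
   [K] above [p + r mu] on the segment from [p] to [q] is strictly higher than [z]. *)
have zr (r : R) : 0 < r -> r <= 1 -> exists z, [/\ Sigma z,
    forall i, `|z 0 i - p 0 i| <= r * (`|mu 0 i| + h),
    forall w, K w -> dotp (w - z) (nu z) <= 0 & 0 <= dotp mu (nu z)].
  move=> r0 r1.
  have Ky : K (p + r *: mu + (r * (h - e1 / 2)) *: E_last).
    have r01 : 0 <= r <= 1 by rewrite ltW.
    have := convex_set_segment vK Kp h2K r01; congr K.
    by apply/rowP => i; rewrite qE !mxE; ring.
  have E0 : - E_last != 0 :> 'rV[R]_n.+1.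
    by apply/rV0Pn; exists ord_max; rewrite !mxE !eqxx oppr_eq0 oner_eq0.
  have [t [t0 Kz tz]] := compact_exit cK Ky E0.
  have nz := exit_not_interior tz.
  have [z zD] : {z : 'rV[R]_n.+1 | z = p + r *: mu + (r * (h - e1 / 2)) *: E_last +
      t *: (- E_last)} by eexists.
  rewrite -zD in Kz nz.
  pose g := r * (h - e1 / 2) - t.
  have zE : z = p + r *: mu + g *: E_last by apply/rowP => i; rewrite zD /g !mxE; ring.
  have z_last : z 0 ord_max = g.
    by rewrite zE !mxE p_last mu_last !eqxx mulr0 !add0r mulr1.
  have g0 : 0 < g.
    rewrite lt_neqAle -[X in _ && (_ <= X)]z_last Klast // andbT.
    apply/negP => /eqP gE; apply: (muout r r0).
    by move: Kz; rewrite zE -gE scale0r addr0.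
  have Sz : Sigma z.
    have : (K `\` interior K) z by [].
    rewrite bdK => -[//|[_]]; rewrite /half_space_boundary /= dotp_E_last z_last => gE.
    by move: g0; rewrite gE ltxx.
  have iz : hs_interior Sigma z.
    case: (cap_embedded cap Sz) => // /(cap_bd cap).
    by rewrite /half_space_boundary /= dotp_E_last z_last => gE; move: g0; rewrite gE ltxx.
  have supp w : K w -> dotp (w - z) (nu z) <= 0.
    apply: (@tangent_plane_support _ _ Sigma) => //.
    - by rewrite z_last.
    - exact/enorm1_dotp/nu1.
    - by move=> v; exact: nuT.
    - exact: nuO.
  have gr : g <= r * h - r * (e1 / 2) by rewrite /g; lra.
  have re1 : 0 < r * (e1 / 2) by rewrite mulr_gt0 // divr_gt0.
  exists z; split=> //.
    move=> i; rewrite zE !mxE eqxx /= mulrDr.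
    rewrite (_ : _ - p 0 i = r * mu 0 i + g * (i == ord_max)%:R); last by ring.
    apply: le_trans (ler_normD _ _) _; rewrite normrM (gtr0_norm r0) lerD2l.
    rewrite normrM gtr0_norm //; apply: (@le_trans _ _ (g * 1)); last by lra.
    by rewrite ler_wpM2l //; [exact: ltW|case: (_ == _); rewrite ?normr1 ?normr0].
  have nuE0 : nu z 0 ord_max <= 0.
    have r01 : 0 <= r <= 1 by rewrite ltW.
    have := supp _ (convex_set_segment vK Kp (interior_subset Kq) r01).
    rewrite (_ : _ - z = (r * h - g) *: E_last); last first.
      by apply/rowP => i; rewrite zE qE !mxE; ring.
    rewrite dotpZl dotpC dotp_E_last pmulr_rle0 //; lra.
  have := supp _ Kp; rewrite (_ : p - z = - r *: mu + (- g) *: E_last); last first.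
    by apply/rowP => i; rewrite zE !mxE; ring.
  rewrite dotpDl !dotpZl [dotp E_last _]dotpC dotp_E_last => H.
  have : g * nu z 0 ord_max <= 0 by rewrite mulr_ge0_le0 // ltW.
  by move=> ?; rewrite -(pmulr_rge0 _ r0); lra.
pose L := 1 + \sum_i (`|mu 0 i| + h).
have hp : 0 < h by lra.
have s0 : 0 <= \sum_i (`|mu 0 i| + h).
  by apply: sumr_ge0 => i _; rewrite addr_ge0 // ltW.
have L0 : 0 < L by rewrite /L; lra.
have small (d : R) : 0 < d -> exists z, [/\ Sigma z,
    forall i, `|z 0 i - p 0 i| < d,
    forall w, K w -> dotp (w - z) (nu z) <= 0 & 0 <= dotp mu (nu z)].
  move=> d0; have dL : 0 < d / L by rewrite divr_gt0.
  have m0 : 0 < Num.min 1 (d / L) / 2 by rewrite divr_gt0 // lt_min ltr01.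
  have m1 : Num.min 1 (d / L) <= 1 by rewrite ge_min lexx.
  have md : Num.min 1 (d / L) <= d / L by rewrite ge_min lexx orbT.
  have [|z [Sz zp supp muz]] := zr _ m0; first by lra.
  exists z; split=> // i; apply: le_lt_trans (zp i) _.
  apply: (@le_lt_trans _ _ (Num.min 1 (d / L) / 2 * L)).
    apply: ler_wpM2l; first exact: ltW.
    rewrite /L (bigD1 i) //= addrCA lerDl addr_ge0 // sumr_ge0 // => j _.
    by rewrite addr_ge0 // ltW.
  by rewrite -ltr_pdivlMr //; lra.
have Sp : Sigma p.
  apply: contrapT => /(closedN_coord closedS)[d d0 dS].
  by have [z [Sz zp _ _]] := small d d0; exact: dS Sz.
have bp : hs_boundary Sigma p.
  case: (cap_embedded cap Sp) => // /(cap_int cap).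
  by rewrite /half_space /= dotp_E_last p_last ltxx.
pose N := nu p.
have approx (d : R) : 0 < d -> exists z : 'rV[R]_n.+1, [/\ forall i, `|z 0 i - p 0 i| <= d,
    forall i, `|(nu z - N) 0 i| <= d, forall i, `|nu z 0 i| <= 1,
    forall w, K w -> dotp (w - z) (nu z) <= 0 & 0 <= dotp mu (nu z)].
  move=> d0; have [d' d'0 H] := within_continuous_coord nuC Sp d0.
  have m0 : 0 < Num.min d d' by rewrite lt_min d0.
  have [z [Sz zp supp muz]] := small _ m0; exists z; split=> // i.
  - by apply: ltW (lt_le_trans (zp i) _); rewrite ge_min lexx.
  - rewrite !mxE; apply/ltW/H => // j.
    by apply: lt_le_trans (zp j) _; rewrite ge_min lexx orbT.
  - by rewrite -(nu1 z Sz) coord_le_enorm.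
have muN : 0 <= dotp mu N.
  rewrite -oppr_le0; apply: (@le0_small _ _ (\sum_i `|mu 0 i|)); first exact: sumr_ge0.
  move=> d /approx[z [_ zN _ _ muz]].
  have := dotp_le_coord mu zN; rewrite [dotp mu _]dotpC dotpBl ![dotp _ mu]dotpC.
  by rewrite ler_norml => /andP[_]; lra.
have suppN w : K w -> dotp (w - p) N <= 0.
  move=> Kw; apply: (@le0_small _ _ (n.+1%:R + \sum_i `|(w - p) 0 i|)).
    by rewrite addr_ge0 // sumr_ge0.
  move=> d /approx[z [zp zN z1 supp _]].
  have := dotp_le_coord (w - p) zN.
  rewrite [dotp (w - p) _]dotpC dotpBl ![dotp _ (w - p)]dotpC ler_norml => /andP[H _].
  have := dotp_le_coord (z - p) z1; rewrite mul1r ler_norml => /andP[_ H2].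
  have H3 : \sum_i `|(z - p) 0 i| <= n.+1%:R * d.
    apply: (@le_trans _ _ (\sum_(i < n.+1) d)).
      by apply: ler_sum => i _; rewrite !mxE.
    by rewrite sumr_const card_ord mulr_natl.
  have := supp w Kw; rewrite (_ : w - z = (w - p) - (z - p)); last first.
    by apply/rowP => i; rewrite !mxE; ring.
  by rewrite dotpBl; lra.
have N1 : dotp N N = 1 by apply/enorm1_dotp/nu1.
have : K (q + (e1 / 2) *: N).
  apply: qK => i; rewrite !mxE addrAC subrr add0r normrM ger0_norm; last by lra.
  apply: (@le_lt_trans _ _ (e1 / 2 * 1)); last by lra.
  by apply: ler_wpM2l; [lra|rewrite -(nu1 p Sp) coord_le_enorm].
move=> /suppN; rewrite (_ : _ - p = mu + h *: E_last + (e1 / 2) *: N); last first.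
  by apply/rowP => i; rewrite qE !mxE; ring.
rewrite !dotpDl !dotpZl N1 [dotp E_last _]dotpC (nuE p bp).
by have := mulr_ge0 (ltW hp) cos0; lra.
Qed.

(** * Inscribed and circumscribed caps *)

Lemma dotp_sqr (R : realType) (m : nat) (u : 'rV[R]_m) : dotp u u = enorm u ^+ 2.
Proof. by rewrite /enorm sqr_sqrtr // dotp_ge0. Qed.

Lemma enorm_le (R : realType) (m : nat) (u : 'rV[R]_m) (r : R) :
  0 <= r -> dotp u u <= r ^+ 2 -> enorm u <= r.
Proof. by move=> r0 ur; rewrite /enorm -(ger0_norm r0) -sqrtr_sqr ler_wsqrtr. Qed.

Lemma cross_polytope_sub (R : realType) (n : nat) (K : set 'rV[R]_n.+1)
    (m u : 'rV[R]_n.+1) (a : R) :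
  convex_set K -> 0 < a -> K m ->
  (forall k, 0 <= u 0 k -> K (m + a *: delta_mx 0 k)) ->
  (forall k, u 0 k < 0 -> K (m - a *: delta_mx 0 k)) ->
  \sum_k `|u 0 k| <= a -> K (m + u).
Proof.
move=> vK a0 Km Kp Kn ua.
pose b k : 'rV[R]_n.+1 := (if 0 <= u 0 k then a else - a) *: delta_mx 0 k.
have -> : u = \sum_k (`|u 0 k| / a) *: b k.
  rewrite {1}[u]row_sum_delta; apply: eq_bigr => k _; rewrite scalerA; congr (_ *: _).
  case: (leP 0 (u 0 k)) => uk; [rewrite ger0_norm //|rewrite ltr0_norm //];
    by field; rewrite gt_eqF.
apply: convex_set_sum => //.
- by move=> k; rewrite /b; case: leP => uk; [exact: Kp|rewrite scaleNr; exact: Kn].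
- by move=> k; rewrite divr_ge0 // ltW.
- by rewrite -mulr_suml ler_pdivrMr // mul1r.
Qed.

Lemma convex_set_average (R : realType) (n : nat) (K : set 'rV[R]_n.+1)
    (z : 'I_n.+1 -> 'rV[R]_n.+1) :
  convex_set K -> (forall i, K (z i)) -> K (n.+1%:R^-1 *: \sum_i z i).
Proof.
move=> vK Kz; have := @convex_set_sum R n K _ (index_enum 'I_n.+1) (z ord0)
  (fun i => z i - z ord0) (fun=> n.+1%:R^-1) vK (Kz ord0).
have n1 : n.+1%:R != 0 :> R by rewrite pnatr_eq0.
have E1 : \sum_(i < n.+1) n.+1%:R^-1 = 1 :> R.
  by rewrite sumr_const card_ord -(mulr_natl n.+1%:R^-1) mulfV.
rewrite E1 -scaler_sumr sumrB sumr_const card_ord -[z ord0 *+ _]scaler_nat scalerBr.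
rewrite scalerA mulVf // scale1r [z ord0 + _]addrC subrK; apply => // i.
by rewrite addrC subrK.
Qed.

(** The centre [m] is the average of the midpoints of the [n + 1] chords; moving only one of these
    along its chord, by at most l / 2, moves the average by at most l / (2 (n + 1)). *)
Lemma chords_cross_polytope (R : realType) (n : nat) (K : set 'rV[R]_n.+1) (l : R) :
  convex_set K -> 0 < l ->
  (forall i, exists x t, [/\ l < t, K x & K (x + t *: delta_mx 0 i)]) ->
  exists2 m, K m & forall k s, `|s| <= l / (2 * n.+1%:R) -> K (m + s *: delta_mx 0 k).
Proof.
move=> vK l0 /choice[x /choice[t H]].
have n0 : 0 < n.+1%:R :> R by rewrite ltr0n.
pose mid i := x i + (t i / 2) *: delta_mx 0 i.
have Kmid i s : `|s| <= l / 2 -> K (mid i + s *: delta_mx 0 i).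
  have [lt Kx Kt] := H i; rewrite ler_norml => /andP[s1 s2].
  have t0 : 0 < t i by lra.
  have st : 0 <= (t i / 2 + s) / t i <= 1.
    by rewrite divr_ge0 ?(ltW t0) /= ?ler_pdivrMr //; lra.
  have := convex_set_segment vK Kx Kt st; congr K.
  rewrite [x i + _ - _]addrAC subrr add0r scalerA divfK ?gt_eqF //.
  by rewrite scalerDl addrA.
have K0 i : K (mid i).
  by have := Kmid i 0; rewrite scale0r addr0 normr0; apply; rewrite divr_ge0 // ltW.
exists (n.+1%:R^-1 *: \sum_i mid i); first exact: convex_set_average.
move=> k s sl; pose z i := mid i + (if i == k then n.+1%:R * s else 0) *: delta_mx 0 i.
have -> : n.+1%:R^-1 *: \sum_i mid i + s *: delta_mx 0 k = n.+1%:R^-1 *: \sum_i z i.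
  have -> : \sum_i z i = \sum_i mid i + (n.+1%:R * s) *: delta_mx 0 k.
    rewrite /z big_split /=; congr (_ + _).
    by rewrite (bigD1 k) //= eqxx big1 ?addr0 // => i /negbTE ->; rewrite scale0r.
  by rewrite scalerDr scalerA mulrA mulVf ?mul1r // gt_eqF.
apply: convex_set_average => // i; rewrite /z; case: ifP => _; last by rewrite scale0r addr0.
apply: Kmid; rewrite normrM gtr0_norm // mulrC -ler_pdivlMr //.
by apply: le_trans sl _; rewrite invfM mulrA.
Qed.

(** The hull of a small cross-polytope around [m] and of a point at distance [tau] from [m]
    contains a tube of length [tau / 2]. *)
Lemma area_ge_extent (R : realType) (n : nat) (w A a : R)
    (Sigma K : set 'rV[R]_n.+1) (m x : 'rV[R]_n.+1) (j : 'I_n.+1) :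
  (0 < n)%N -> 0 < w -> lebesgue_outer (@unit_ball R n) = w%:E ->
  (hausdorff n Sigma < A%:E)%E -> convex_set K ->
  (forall y i, K y -> exists t, Sigma (y + t *: delta_mx 0 i)) ->
  0 < a -> K m -> (forall k s, `|s| <= a -> K (m + s *: delta_mx 0 k)) -> K x ->
  (a / n.+1%:R) ^+ n.-1 * (`|x 0 j - m 0 j| / 2) <= 2 ^+ n * (2 ^+ n / w) * A.
Proof.
move=> n0 w0 Ew SA vK KS a0 Km Kma Kx.
have A0 : 0 <= A by rewrite -lee_fin; apply: le_trans (ltW SA); exact: hausdorff_ge0.
have N0 : 0 < n.+1%:R :> R by rewrite ltr0n.
have [E|xm] := eqVneq (x 0 j) (m 0 j).
  rewrite E subrr normr0 mul0r mulr0 !mulr_ge0 ?exprn_ge0 ?invr_ge0 // ltW //.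
pose v := x 0 j - m 0 j; have v0 : v != 0 by rewrite subr_eq0.
have [i ij] : exists i : 'I_n.+1, i != j.
  have [->|j0] := eqVneq j ord0; last by exists ord0; rewrite eq_sym.
  by exists ord_max; rewrite -val_eqE /= -lt0n.
pose c tau : 'rV[R]_n.+1 := m + ((tau - m 0 j) / v) *: (x - m).
pose s := a / (2 * n.+1%:R); have s0 : 0 < s by rewrite divr_gt0 // mulr_gt0.
pose t0 := Num.min (m 0 j) (m 0 j + v / 2); pose t1 := Num.max (m 0 j) (m 0 j + v / 2).
have t01 : t1 - t0 = `|v| / 2.
  rewrite /t1 /t0; case: (ltrP v 0) => vs.
    by rewrite (@ltr0_norm _ v) // minEle maxEle !ifF; lra.
  by rewrite (@ger0_norm _ v) // minEle maxEle !ifT; lra.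
have -> : a / n.+1%:R = 2 * s by rewrite /s; field; rewrite gt_eqF.
rewrite -/v -t01; apply: (@area_ge_tube _ _ w A t0 t1 s Sigma i j c) => //.
- by rewrite -subr_ge0 t01 divr_ge0.
- exact: ltW.
move=> tau y /andP[tau0 tau1] yj yc; apply: KS.
pose sg := (tau - m 0 j) / v.
have /andP[sg0 sg1] : 0 <= sg <= 1 / 2.
  move: tau0 tau1; rewrite /t0 /t1 /sg; case: (ltrP v 0) => vs.
    rewrite minEle maxEle !ifF; try lra; move=> ? ?.
    by rewrite ler_ndivlMr // ler_ndivrMr //; lra.
  have vp : 0 < v by rewrite lt_neqAle eq_sym v0.
  rewrite minEle maxEle !ifT; try lra; move=> ? ?.
  by rewrite ler_pdivlMr // ler_pdivrMr //; lra.
have sg2 : 0 < 1 - sg by lra.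
pose u := (1 - sg)^-1 *: (y - c tau).
have uk k : `|(y - c tau) 0 k| <= s.
  have [->|kj] := eqVneq k j; last by have := yc k kj; rewrite !mxE.
  have -> : (y - c tau) 0 j = 0 by rewrite !mxE yj -/v divfK //; ring.
  by rewrite normr0 ltW.
have Ku : K (m + u).
  apply: (@cross_polytope_sub _ _ _ _ _ a) => //.
  - by move=> k _; apply: Kma; rewrite gtr0_norm.
  - by move=> k _; rewrite -scaleNr; apply: Kma; rewrite normrN gtr0_norm.
  apply: (@le_trans _ _ (\sum_(k < n.+1) (1 - sg)^-1 * s)).
    apply: ler_sum => k _; rewrite /u mxE normrM gtr0_norm ?invr_gt0 //.
    by apply: ler_wpM2l; rewrite ?invr_ge0 // ltW.
  rewrite sumr_const card_ord -mulr_natl mulrCA ler_pdivrMl // /s.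
  rewrite (_ : n.+1%:R * _ = a / 2); last by field; rewrite gt_eqF.
  by have := ler_wpM2r (ltW a0) sg1; lra.
have sg01 : 0 <= sg <= 1 by lra.
have := convex_set_segment vK Ku Kx sg01; congr K.
apply/rowP => k; rewrite /u /c -/sg !mxE; field; rewrite gt_eqF //.
Qed.

(** [K] contains the projection [m'] of [m], the projections of the horizontal vertices of the
    cross-polytope around [m], and, as [m] is at height at least [a], the point at height [a]
    above [m']. *)
Lemma rho_minus_ge (R : realType) (n : nat) (theta a : R)
    (K : set 'rV[R]_n.+1) (m : 'rV[R]_n.+1) :
  0 <= cos theta -> convex_set K -> K `<=` closed_half_space ->
  (forall x, K x -> K (x - x 0 ord_max *: E_last)) ->
  0 < a -> K m -> (forall k s, `|s| <= a -> K (m + s *: delta_mx 0 k)) ->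
  ((a / n.+1%:R)%:E <= rho_minus K theta)%E.
Proof.
move=> c0 vK Kh Kproj a0 Km Kma.
have N0 : 0 < n.+1%:R :> R by rewrite ltr0n.
have [m' m'E] : {m' : 'rV[R]_n.+1 | m' = m - m 0 ord_max *: E_last} by eexists.
have m'0 : m' 0 ord_max = 0 by rewrite m'E !mxE !eqxx mulr1 subrr.
apply: ereal_sup_ubound; exists (a / n.+1%:R) => //=.
split; first by rewrite divr_gt0.
exists m'; split; first by rewrite /half_space_boundary /= dotp_E_last.
set r := a / n.+1%:R; have r0 : 0 < r by rewrite divr_gt0.
have rc0 : 0 <= r * cos theta by rewrite mulr_ge0 // ltW.
move=> y [/=]; rewrite /closed_half_space /= dotp_E_last => y0 yr.
have yk k : `|y 0 k - m' 0 k + r * cos theta * (k == ord_max)%:R| <= r.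
  have := le_trans (coord_le_enorm _ k) yr; congr (`|_| <= r).
  by rewrite !mxE eqxx /=; ring.
have horiz k s : k != ord_max -> `|s| <= a -> K (m' + s *: delta_mx 0 k).
  move=> kn /(Kma k)/Kproj; congr K; apply/rowP => l; rewrite m'E !mxE !eqxx /=.
  by rewrite [ord_max == k]eq_sym (negbTE kn) mulr0 addr0; ring.
have vert : K (m' + a *: E_last).
  have ma : a <= m 0 ord_max.
    have := Kma ord_max (- a); rewrite normrN gtr0_norm // => /(_ (lexx _))/Kh.
    by rewrite /closed_half_space /= dotp_E_last !mxE !eqxx /= mulr1; lra.
  have m0 : 0 < m 0 ord_max by lra.
  have am : 0 <= a / m 0 ord_max <= 1 by rewrite ler_pdivrMr // mul1r ma divr_ge0 // ltW.
  have := convex_set_segment vK (Kproj _ Km) Km am; congr K.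
  rewrite -m'E; congr (_ + _); apply/rowP => l; rewrite m'E !mxE; field; rewrite gt_eqF //.
rewrite -[y](subrK m') addrC; apply: (@cross_polytope_sub _ _ _ _ _ a) => //.
- by rewrite m'E; exact: Kproj.
- move=> k _; have [->|kn] := eqVneq k ord_max; first exact: vert.
  by apply: horiz; rewrite // gtr0_norm.
- move=> k uk; have kn : k != ord_max.
    by apply: contraTneq uk => ->; rewrite !mxE m'0 subr0 -leNgt.
  by rewrite -scaleNr; apply: horiz; rewrite // normrN gtr0_norm.
apply: (@le_trans _ _ (\sum_(k < n.+1) r)); last first.
  by rewrite sumr_const card_ord -(mulr_natl r) /r mulrC divfK // gt_eqF.
apply: ler_sum => k _; have := yk k; rewrite !mxE.
have [->|kn] := eqVneq k ord_max; last by rewrite mulr0 addr0.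
rewrite m'0 subr0 mulr1 !ger0_norm //; [lra|exact: addr_ge0].
Qed.

(** The ball of radius [rho] around [m'] is in the ball of radius [r = rho + r cos theta] around
    [m' - r cos theta E]. *)
Lemma rho_plus_le (R : realType) (n : nat) (theta d : R)
    (K : set 'rV[R]_n.+1) (m : 'rV[R]_n.+1) :
  0 <= cos theta -> cos theta < 1 -> K `<=` closed_half_space ->
  (forall x, K x -> K (x - x 0 ord_max *: E_last)) ->
  0 < d -> K m -> (forall x k, K x -> `|x 0 k - m 0 k| <= d) ->
  (rho_plus K theta <= (n.+1%:R * (2 * d) / (1 - cos theta))%:E)%E.
Proof.
move=> c0 c1 Kh Kproj d0 Km Kd.
have N0 : 0 < n.+1%:R :> R by rewrite ltr0n.
have c10 : 0 < 1 - cos theta by rewrite subr_gt0.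
have [m' m'E] : {m' : 'rV[R]_n.+1 | m' = m - m 0 ord_max *: E_last} by eexists.
have m'0 : m' 0 ord_max = 0 by rewrite m'E !mxE !eqxx mulr1 subrr.
set rho := n.+1%:R * (2 * d); set r := rho / _.
have rho0 : 0 < rho by rewrite /rho !mulr_gt0.
have r0 : 0 < r by rewrite /r divr_gt0.
apply: ereal_inf_lbound; exists r => //=; split=> //.
exists m'; split; first by rewrite /half_space_boundary /= dotp_E_last.
move=> x Kx; split; first exact: Kh.
have /andP[ml0 mld] : 0 <= m 0 ord_max <= d.
  have := Kh _ Km; rewrite /closed_half_space /= dotp_E_last => -> /=.
  have := Kd _ ord_max (Kproj _ Km); rewrite -m'E m'0 sub0r normrN.
  by apply: le_trans; exact: ler_norm.
have [u uE] : {u : 'rV[R]_n.+1 | u = x - m'} by eexists.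
have urho : enorm u <= rho.
  apply: enorm_le_coord => k; have := Kd x k Kx; rewrite uE m'E !mxE eqxx /=.
  have [->|kn] := eqVneq k ord_max; last by rewrite mulr0 subr0; lra.
  by rewrite mulr1 subrr subr0 !ler_norml => /andP[? ?]; apply/andP; split; lra.
have -> : x - (m' - (r * cos theta) *: E_last) = u + (r * cos theta) *: E_last.
  by rewrite uE opprB addrCA addrC.
apply: enorm_le; first exact: ltW.
rewrite dotpDl !dotpZl ![dotp _ (u + _)]dotpC !dotpDl !dotpZl.
rewrite [dotp E_last u]dotpC !dotp_E_last dotp_sqr [E_last _ _]mxE !eqxx mulr1.
set s := r * cos theta; have s0 : 0 <= s by rewrite mulr_ge0 // ltW.
have -> : r = rho + s by rewrite /s /r; field; rewrite gt_eqF.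
have u0 : 0 <= enorm u by exact: sqrtr_ge0.
have ul : u 0 ord_max <= rho.
  by apply: le_trans urho; apply: le_trans (coord_le_enorm u ord_max); exact: ler_norm.
have : 0 <= s * (rho - u 0 ord_max) by rewrite mulr_ge0 // subr_ge0.
have : enorm u ^+ 2 <= rho ^+ 2 by rewrite ler_pXn2r // nnegrE ltW.
by rewrite !expr2; nra.
Qed.

(** * The isoperimetric ratio *)

Lemma base_area_le (R : realType) (n : nat) (Sigma K : set 'rV[R]_n.+1) :
  enclosed_domain Sigma K -> convex_set K -> closed Sigma ->
  (hausdorff n (K `&` half_space_boundary) <= hausdorff n Sigma)%E.
Proof.
move=> dom vK cS.
apply: (@hausdorff_lipschitz R _ n _ (fun x : 'rV[R]_n.+1 => x - x 0 ord_max *: E_last)).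
  move=> x y; apply: ler_wsqrtr; apply: ler_sum => i _; rewrite -!expr2 !mxE.
  have [->|_] := eqVneq i ord_max; last by rewrite !mulr0 !subr0.
  by rewrite !mulr1 !subrr expr0n sqr_ge0.
move=> y [Ky]; rewrite /half_space_boundary /= dotp_E_last => y0.
have [t [_ _ St]] := exit_through ord_max dom vK cS Ky.
exists (y + t *: delta_mx 0 ord_max) => //.
by apply/rowP => i; rewrite !mxE !eqxx y0 /=; ring.
Qed.

(** As the base is no larger than [Sigma], the capillary area is at least
    [(1 - cos theta)] times the area of [Sigma]. *)
Lemma isoperimetric_bound (R : realType) (n : nat) (theta c1 : R)
    (Sigma K : set 'rV[R]_n.+1) :
  (0 < n)%N -> 0 <= cos theta -> cos theta < 1 ->
  enclosed_domain Sigma K -> convex_set K -> closed Sigma ->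
  (0 < hausdorff n Sigma)%E -> (isoperimetric_ratio theta Sigma K <= c1%:E)%E ->
  exists A V : R, [/\ hausdorff n Sigma = A%:E, lebesgue_outer K = V%:E, 0 < A, 0 < V &
    ((1 - cos theta) * A) ^+ n.+1 <= c1 * V ^+ n].
Proof.
move=> n0 c0 c1' dom vK cS; have BA := base_area_le dom vK cS.
have [cK _ _ _ _] := dom; have [M M0 KM] := compact_coord_bounded cK.
have : hausdorff n (K `&` half_space_boundary) \is a fin_num.
  rewrite ge0_fin_numE ?hausdorff_ge0 //; apply: (@hausdorff_flat_lt _ _ _ M) => //.
  move=> x [Kx]; rewrite /half_space_boundary /= dotp_E_last => x0; split=> // i.
  exact: KM.
have : lebesgue_outer K \is a fin_num.
  rewrite ge0_fin_numE ?lebesgue_outer_ge0 //.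
  by apply: (@lebesgue_outer_box_lt _ _ _ M) => // x i; exact: KM.
have := lebesgue_outer_ge0 K; have := hausdorff_ge0 n (K `&` half_space_boundary).
rewrite /isoperimetric_ratio /capillary_area; move: BA.
case: (hausdorff n (K `&` _)) => // B; case: (lebesgue_outer K) => // V BA; rewrite !lee_fin.
move=> B0 V0 _ _; have invV : V = 0 -> (V%:E ^+ n)^-1%E = +oo%E.
  by move=> ->; rewrite -EFin_expe expr0n eqn0Ngt n0 inver eqxx.
have invVp : 0 < V -> (V%:E ^+ n)^-1%E = ((V ^+ n)^-1)%:E.
  by move=> Vp; rewrite -EFin_expe inver gt_eqF ?exprn_gt0.
have powoo k : (+oo ^+ k.+1 = +oo :> \bar R)%E.
  by elim: k => [//|k IH]; rewrite expeS IH mulyy.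
case: (hausdorff n Sigma) BA => [A||//] BA A0; last first.
  rewrite -EFinM addye // powoo.
  have [V0'|Vp] := eqVneq V 0; first by rewrite invV // mulyy.
  have {}Vp : 0 < V by rewrite lt_neqAle eq_sym Vp.
  by rewrite invVp // gt0_mulye // lte_fin invr_gt0 exprn_gt0.
rewrite lee_fin in BA; rewrite lte_fin in A0.
have WA : (1 - cos theta) * A <= A - cos theta * B.
  by rewrite mulrBl mul1r lerD2l lerN2 ler_wpM2l.
have WA0 : 0 < (1 - cos theta) * A by rewrite mulr_gt0 // subr_gt0.
have W0 : 0 < A - cos theta * B by apply: lt_le_trans WA.
rewrite -EFinM -EFinB -EFin_expe.
have [V0'|Vn] := eqVneq V 0.
  by rewrite invV // gt0_muley // lte_fin exprn_gt0.
have Vp : 0 < V by rewrite lt_neqAle eq_sym Vn.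
rewrite invVp // -EFinM lee_fin => H; exists A, V; split=> //.
rewrite -ler_pdivrMr ?exprn_gt0 //; apply: le_trans H.
by rewrite ler_wpM2r ?invr_ge0 ?exprn_ge0 // lerXn2r // nnegrE ltW.
Qed.

(** * Comparison of the radii *)

(** An interior point of [K] has a small cross-polytope around it, to which [area_ge_extent]
    applies. *)
Lemma area_gt0 (R : realType) (n : nat) (Sigma K : set 'rV[R]_n.+1) :
  (0 < n)%N -> enclosed_domain Sigma K -> convex_set K ->
  (forall y i, K y -> exists t, Sigma (y + t *: delta_mx 0 i)) ->
  K !=set0 -> (0 < hausdorff n Sigma)%E.
Proof.
move=> n0 [_ _ _ clK _] vK KS [x Kx]; have [w w0 Ew] := lebesgue_outer_unit_ball R n0.
have [q /nbhs_coord[e e0 qK] _] := interior_dense clK Kx ltr01.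
have e20 : 0 < e / 2 by rewrite divr_gt0.
have Kq : K q by apply: qK => i; rewrite subrr normr0.
have Kqe k s : `|s| <= e / 2 -> K (q + s *: delta_mx 0 k).
  move=> se; apply: qK => i; rewrite !mxE eqxx /= addrAC subrr add0r.
  by case: (i == k); rewrite ?mulr1 ?mulr0 ?normr0 //; lra.
rewrite lt_neqAle hausdorff_ge0 andbT; apply/negP => /eqP A0.
have : 0 < (e / 2 / n.+1%:R) ^+ n.-1 * (e / 2 / 2).
  by rewrite mulr_gt0 ?exprn_gt0 ?divr_gt0 ?ltr0n.
apply/negP; rewrite -leNgt; apply: (@le0_small _ _ (2 ^+ n * (2 ^+ n / w))).
  by rewrite mulr_ge0 ?divr_ge0 ?exprn_ge0 // ltW.
move=> d d0.
have := @area_ge_extent _ n w d (e / 2) Sigma K q (q + (e / 2) *: delta_mx 0 ord0) ord0.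
rewrite -A0 lte_fin [in X in X -> _]d0.
rewrite !mxE !eqxx /= mulr1 addrAC subrr add0r (gtr0_norm e20) [d * _]mulrC; apply => //.
by apply: Kqe; rewrite gtr0_norm.
Qed.

Theorem proposition2p4 (R : realType) (n : nat) (theta c1 : R)
    (hn : (1 <= n)%N) (htheta0 : 0 < theta) (htheta1 : theta <= pi / 2)
    (hc1 : 0 < c1) :
  exists c : R, 0 < c /\
    forall Sigma K : set 'rV[R]_n.+1,
      convex_capillary theta Sigma K ->
      (isoperimetric_ratio theta Sigma K <= c1%:E)%E ->
      (rho_plus K theta <= c%:E * rho_minus K theta)%E.
Proof.
have pi0 := pi_gt0 R.
have cos0 : 0 <= cos theta by apply: cos_ge0_pihalf; lra.
have cos1 : cos theta < 1.
  have : 0 < sin theta by apply: sin_gt0_pi; lra.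
  by have := cos2Dsin2 theta; rewrite !expr2; nra.
have cos10 : 0 < 1 - cos theta by rewrite subr_gt0.
have [w w0 Ew] := lebesgue_outer_unit_ball R hn.
have N0 : 0 < n.+1%:R :> R by rewrite ltr0n.
(* The factor that relates Hausdorff sums to covers by cubes *)
pose C0 : R := 2 ^+ n * (2 ^+ n / w).
have C00 : 0 < C0 by rewrite mulr_gt0 ?divr_gt0 ?exprn_gt0.
(* Chords of length at most [l] along one axis would imply [V <= kappa * A * l]. *)
pose kappa : R := 6 * C0; have kappa0 : 0 < kappa by rewrite mulr_gt0.
(* [A <= C1 * l ^+ n], from the isoperimetric bound and [V = 2 * kappa * A * l] *)
pose C1 := c1 * (2 * kappa) ^+ n / (1 - cos theta) ^+ n.+1.
have C10 : 0 < C1.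
  apply: divr_gt0; last exact: exprn_gt0.
  by apply: mulr_gt0 => //; apply: exprn_gt0; exact: mulr_gt0.
have N20 : 0 < 2 * n.+1%:R ^+ 2 :> R by rewrite mulr_gt0 // exprn_gt0.
(* The extent of [K] around [m] is at most [C2 * l]. *)
pose C2 := 4 * C0 * C1 * (2 * n.+1%:R ^+ 2) ^+ n.-1.
have C20 : 0 < C2.
  by apply: mulr_gt0; [apply: mulr_gt0 => //; exact: mulr_gt0|exact: exprn_gt0].
pose c := n.+1%:R * (2 * C2) / (1 - cos theta) * (2 * n.+1%:R ^+ 2).
have c0 : 0 < c.
  by apply: mulr_gt0 => //; apply: divr_gt0 => //; apply: mulr_gt0 => //; exact: mulr_gt0.
exists c; split=> //.
move=> Sigma K [cap vK] ratio; have dom := cap_enclosed cap; have [_ Kh _ _ bdK] := dom.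
have cS : closed Sigma.
  by apply: compact_closed; [exact: norm_hausdorff|exact: cap_compact cap].
have SK z : Sigma z -> K z.
  by move=> Sz; have : (K `\` interior K) z; [rewrite bdK; left|case].
have Kproj x : K x -> K (x - x 0 ord_max *: E_last).
  exact: capillary_projection cos0 cap vK.
have KS y i : K y -> exists t, Sigma (y + t *: delta_mx 0 i).
  by move=> Ky; have [t [_ _ St]] := exit_through i dom vK cS Ky; exists t.
have K0 : K !=set0 by have [p [/SK Kp _]] := cap_bd_nonempty cap; exists p.
have A0 := area_gt0 hn dom vK KS K0.
have [A [V [EA EV {}A0 V0 iso]]] := isoperimetric_bound hn cos0 cos1 dom vK cS A0 ratio.
have SA2 : (hausdorff n Sigma < (2 * A)%:E)%E by rewrite EA lte_fin; lra.
pose l := V / (2 * kappa * A).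
have kA0 : 0 < 2 * kappa * A by apply: mulr_gt0 => //; exact: mulr_gt0.
have l0 : 0 < l by exact: divr_gt0.
have VE : V = 2 * kappa * A * l by rewrite /l mulrC divfK // gt_eqF.
have AC : A <= C1 * l ^+ n.
  rewrite /C1 mulrAC ler_pdivlMr ?exprn_gt0 // -(ler_pM2r (exprn_gt0 n A0)).
  have : ((1 - cos theta) * A) ^+ n.+1 <= c1 * V ^+ n by [].
  rewrite VE !exprMn exprS; congr (_ <= _); first by rewrite [A ^+ n.+1]exprS; ring.
  by ring.
have chords i : exists x t, [/\ l < t, K x & K (x + t *: delta_mx 0 i)].
  apply: contrapT => nochord.
  have : (lebesgue_outer K <= (3 * 2 ^+ n * (2 ^+ n / w) * (2 * A) * l)%:E)%E.
    apply: (@volume_le_chord_area _ _ _ _ _ Sigma _ i) => // x Kx.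
    have [t [t0 Kt St]] := exit_through i dom vK cS Kx.
    exists t => //; rewrite t0 /= leNgt; apply/negP => lt_t.
    by apply: nochord; exists x, t.
  rewrite EV lee_fin leNgt => /negP; apply.
  rewrite (_ : _ * l = V / 2); first by lra.
  by rewrite [in RHS]VE /kappa /C0; field; rewrite gt_eqF.
have [m Km Kma] := chords_cross_polytope vK l0 chords.
set a := l / (2 * n.+1%:R) in Kma.
have a0 : 0 < a by rewrite divr_gt0 // mulr_gt0.
have Kd x k : K x -> `|x 0 k - m 0 k| <= C2 * l.
  move=> Kx; have := area_ge_extent k hn w0 Ew SA2 vK KS a0 Km Kma Kx.
  rewrite -/C0 => ext; set tau := `|_| in ext *.
  have p0 : 0 < (a / n.+1%:R) ^+ n.-1 by rewrite exprn_gt0 // divr_gt0.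
  rewrite -(ler_pM2l p0).
  apply: (@le_trans _ _ (4 * C0 * (C1 * l ^+ n))).
    have := ler_wpM2l (ltW C00) AC; lra.
  rewrite le_eqVlt; apply/orP; left; apply/eqP.
  rewrite -[in LHS](prednK hn) exprS /C2.
  have -> : l ^+ n.-1 = (a / n.+1%:R) ^+ n.-1 * (2 * n.+1%:R ^+ 2) ^+ n.-1.
    by rewrite -exprMn /a; congr (_ ^+ _); field; rewrite gt_eqF.
  by ring.
have Cl0 : 0 < C2 * l by rewrite mulr_gt0.
apply: le_trans (rho_plus_le cos0 cos1 Kh Kproj Cl0 Km Kd) _.
have := rho_minus_ge cos0 vK Kh Kproj a0 Km Kma.
have c_ge0 : (0 <= c%:E)%E by rewrite lee_fin ltW.
move=> /(lee_wpmul2l c_ge0); apply: le_trans.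
rewrite -EFinM lee_fin le_eqVlt; apply/orP; left; apply/eqP.
by rewrite /c /a; field; rewrite !gt_eqF.
Qed.
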